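(* For every positive integer $n$, the following four kinds of combinatorial objects are equivalent, i.e. in canonical bijection with each other: (1) submodular rank tests on $S_n$; (2) Minkowski summands of the permutohedron $\mathbf{P}_n$ (up to equality of normal fans); (3) structural conditional independence models on $[n]$; (4) nonempty faces of the submodular cone $\mathbf{C}_n$. The correspondence is as follows. To a submodular function $w:2^{[n]}\to\mathbb{R}$ with $w(\emptyset)=0$ associate (1) the rank test given by the normal fan of $Q_w$; (2) the polytope $Q_w$ up to equality of normal fans; (3) the set of all CI statements $i\perp\!\!\!\perp j\mid K$ with $w(K\cup\{i\})+w(K\cup\{j\})=w(K\cup\{i,j\})+w(K)$; (4) the smallest face of $\mathbf{C}_n$ containing $w$. Each of these four assignments maps onto the set of all objects of the respective kind, and for any two submodular functions $w,w'$ with $w(\emptyset)=w'(\emptyset)=0$, if the objects associated with $w$ and $w'$ coincide for one of the four kinds, then they coincide for all four.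
   Context: $[n]=\{1,\dots,n\}$, $2^{[n]}$ is the collection of all subsets of $[n]$, and $S_n$ is the set of permutations of $[n]$. A function $w:2^{[n]}\to\mathbb{R}$ is submodular if $w(I)+w(J)\ge w(I\cap J)+w(I\cup J)$ for all $I,J\subseteq[n]$. The submodular cone $\mathbf{C}_n\subset\mathbb{R}^{2^n}$ is the cone of all submodular functions; it has lineality space $\mathbf{C}_n\cap(-\mathbf{C}_n)$ and is considered modulo this space (a face of $\mathbf{C}_n$ contains the lineality space). For $w$ with $w(\emptyset)=0$, $$Q_w=\Bigl\{x\in\mathbb{R}^n : x_1+\cdots+x_n=w([n]),\ \sum_{i\in I}x_i\le w(I)\text{ for all }\emptyset\ne I\subseteq[n]\Bigr\}.$$ Normal fans are taken with respect to maximization: the cones of the normal fan of a polytope $Q\subset\mathbb{R}^n$ are the closures of the classes of vectors $u\in\mathbb{R}^n$ for which the face of $Q$ maximizing $u\cdot x$ is the same. Two vectors $u,v\in\mathbb{R}^n$ are permutation equivalent if for all $i,j$: $u_i<u_j$ iff $v_i<v_j$, and $u_i=u_j$ iff $v_i=v_j$. The closures of the equivalence classes form the $S_n$-fan, whose maximal cones are $\{u:u_{\delta_1}\ge\cdots\ge u_{\delta_n}\}$, indexed by permutations $\delta=(\delta_1,\dots,\delta_n)$. A coarsening of the $S_n$-fan is a fan $\mathcal{F}$ such that every permutation equivalence class lies in a cone of $\mathcal{F}$. A convex rank test is the partition of $S_n$ defined by a coarsening $\mathcal{F}$ (two permutations are in the same class iff their maximal cones lie in the same maximal cone of $\mathcal{F}$);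 the test is identified with the fan. A submodular rank test is a convex rank test whose fan is the normal fan of $Q_w$ for some submodular $w$ with $w(\emptyset)=0$. The permutohedron $\mathbf{P}_n$ is the convex hull of all vectors $(\rho_1,\dots,\rho_n)\in\mathbb{R}^n$ with $\{\rho_1,\dots,\rho_n\}=[n]$; its normal fan is the $S_n$-fan. A convex polytope is a (Minkowski) summand of another polytope if the normal fan of the latter refines the normal fan of the former. A CI statement is $i\perp\!\!\!\perp j\mid K$ with $i\neq j$ in $[n]$ and $K\subseteq[n]\setminus\{i,j\}$ (symmetric in $i,j$). The associated elementary imset is the vector $u_{\langle i,j|K\rangle}=e_{K\cup\{i,j\}}+e_K-e_{K\cup\{i\}}-e_{K\cup\{j\}}\in\mathbb{Z}^{2^{[n]}}$, where $e_I$ are the unit vectors. A vector $u\in\mathbb{Z}^{2^{[n]}}$ is a structural imset if some positive integer multiple of $u$ is a nonnegative integer combination of elementary imsets. The CI model of a structural imset $u$ is the set of all CI statements $i\perp\!\!\!\perp j\mid K$ such that $m\,u-u_{\langle i,j|K\rangle}$ is a structural imset for some positive integer $m$. A structural conditional independence model is a set of CI statements that is the CI model of some structural imset. *)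

(* Defs.v *)
From mathcomp Require Import all_boot all_order all_algebra all_fingroup.
From mathcomp Require Import boolp classical_sets functions cardinality reals.
From mathcomp Require Import topology normedtype convex.

Set Implicit Arguments.
Unset Strict Implicit.
Unset Printing Implicit Defensive.

Import Order.TTheory GRing.Theory Num.Theory.
Import numFieldNormedType.Exports.

Local Open Scope classical_set_scope.
Local Open Scope ring_scope.

(* The ground set [n] = {1, ..., n} is 'I_n = {0, ..., n - 1}. Vectors of R^n
   are row vectors; set functions, i.e. vectors of R^(2^n), are finite
   functions on {set 'I_n} (with values in R^o, so that they form an
   lmodType R). *)

Notation set_function R n := {ffun {set 'I_n} -> R^o}.

Section Polyhedra.
Variable R : realType.

(* Faces are cut out by valid inequalities [l x <= b]; the empty set and C
   itself may occur among them. *)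
Definition is_face (V : lmodType R) (C F : set V) : Prop :=
  exists (l : {scalar V}) (b : R),
    (forall x, C x -> l x <= b) /\ F = [set x | C x /\ l x = b].

Variable n : nat.
Implicit Types (u v x y : 'rV[R]_n) (C D Q : set 'rV[R]_n).
Implicit Types F G : set (set 'rV[R]_n).

Definition dot u x : R := \sum_(i < n) u 0 i * x 0 i.

Definition conv_hull (S : set 'rV[R]_n) : set 'rV[R]_n :=
  smallest (@convex_set R 'rV[R]_n) S.

Definition is_polytope Q : Prop :=
  exists S, [/\ finite_set S, S !=set0 & Q = conv_hull S].

Definition polyhedral_cone C : Prop :=
  exists s : seq 'rV[R]_n, C = [set u | forall a, a \in s -> dot a u <= 0].

Definition is_fan F : Prop :=
  [/\ finite_set F,
      forall C, F C -> polyhedral_cone C,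
      forall C D, F C -> is_face C D -> D !=set0 -> F D
    & forall C D, F C -> F D ->
        is_face C (C `&` D) /\ is_face D (C `&` D)].

Definition max_cone F C : Prop :=
  F C /\ forall D, F D -> C `<=` D -> D = C.

(* For complete fans (the only ones to which this is applied) this is the usual
   refinement relation: F refines G. *)
Definition refines F G : Prop :=
  forall C, F C -> exists2 D, G D & C `<=` D.

Definition max_face Q u : set 'rV[R]_n :=
  [set x | Q x /\ forall y, Q y -> dot u y <= dot u x].

Definition normal_fan Q : set (set 'rV[R]_n) :=
  [set closure [set v | max_face Q v = max_face Q u] | u in setT].

Definition normal_class Q : set (set 'rV[R]_n) :=
  [set Q' | is_polytope Q' /\ normal_fan Q' = normal_fan Q].

Definition minkowski_summand Q P : Prop :=
  is_polytope Q /\ refines (normal_fan P) (normal_fan Q).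

Definition permutohedron : set 'rV[R]_n :=
  conv_hull [set \row_(i < n) ((rho i).+1)%:R | rho in [set: 'S_n]].

Definition perm_equiv u v : Prop :=
  forall i j, (u 0 i < u 0 j <-> v 0 i < v 0 j) /\
              (u 0 i = u 0 j <-> v 0 i = v 0 j).

Definition coarsens_Sn_fan F : Prop :=
  is_fan F /\ forall u, exists2 C, F C & [set v | perm_equiv u v] `<=` C.

(* Permutations are in one-line notation: delta lists the coordinates of u in
   weakly decreasing order. *)
Definition chamber (delta : 'S_n) : set 'rV[R]_n :=
  [set u | forall i j : 'I_n, (i <= j)%N -> u 0 (delta j) <= u 0 (delta i)].

Definition same_class F (d d' : 'S_n) : Prop :=
  exists C, [/\ max_cone F C, chamber d `<=` C & chamber d' `<=` C].

Definition rank_test F : {set {set 'S_n}} :=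
  equivalence_partition (fun d d' => `[< same_class F d d' >])
                        [set: 'S_n]%SET.

Definition convex_rank_test_of F (T : {set {set 'S_n}}) : Prop :=
  coarsens_Sn_fan F /\ T = rank_test F.

End Polyhedra.

Arguments permutohedron : clear implicits.

Section Submodular.
Variables (R : realType) (n : nat).
Implicit Types w : set_function R n.

Definition submodular w : Prop :=
  forall I J : {set 'I_n}, w (I :&: J) + w (I :|: J) <= w I + w J.

Definition submodular_cone : set (set_function R n) := [set w | submodular w].

Definition submodular0 : set (set_function R n) :=
  [set w | submodular w /\ w finset.set0 = 0].

Definition Qpolytope w : set 'rV[R]_n :=
  [set x | \sum_(i < n) x 0 i = w [set: 'I_n]%SET /\
     forall I : {set 'I_n}, I != finset.set0 -> \sum_(i in I) x 0 i <= w I].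

Definition submodular_rank_test (T : {set {set 'S_n}}) : Prop :=
  exists2 F : set (set 'rV[R]_n), convex_rank_test_of F T &
    exists2 w, submodular0 w & F = normal_fan (Qpolytope w).

(* An intersection of faces, since [smallest C G] is the intersection of all
   the sets that satisfy C and contain G. Normalizing w at the empty set only
   chooses a representative modulo the lineality space, which every nonempty
   face contains. *)
Definition smallest_face w : set (set_function R n) :=
  smallest (is_face submodular_cone) [set w].

End Submodular.

Arguments submodular_cone : clear implicits.
Arguments submodular0 : clear implicits.
Arguments submodular_rank_test : clear implicits.

(* The triple (i, j, K) stands for the statement "i and j are independent given
   K". Statements are symmetric in i and j; both orderings are kept, which
   changes neither the structural imsets nor equality of models. *)
Notation triple n := ('I_n * 'I_n * {set 'I_n})%type.
Notation imset n := {ffun {set 'I_n} -> int}.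

Section CondIndep.
Variable n : nat.

Definition is_ci (s : triple n) : bool :=
  let: (i, j, K) := s in [&& i != j, i \notin K & j \notin K].

Definition unit_imset (I : {set 'I_n}) : imset n := [ffun J => (J == I)%:R].

Definition elementary_imset (s : triple n) : imset n :=
  let: (i, j, K) := s in
  unit_imset (i |: (j |: K)) + unit_imset K
    - unit_imset (i |: K) - unit_imset (j |: K).

Definition structural_imset (u : imset n) : Prop :=
  exists2 m : nat, (0 < m)%N &
    exists c : triple n -> nat,
      u *+ m = \sum_(s : triple n | is_ci s)
                  elementary_imset s *+ c s.

Definition ci_model (u : imset n) : set (triple n) :=
  [set s | is_ci s /\
     exists2 m : nat, (0 < m)%N &
       structural_imset (u *+ m - elementary_imset s)].

Definition structural_ci_model (M : set (triple n)) : Prop :=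
  exists2 u, structural_imset u & M = ci_model u.

Definition ci_of (R : realType) (w : set_function R n) : set (triple n) :=
  [set s | is_ci s /\
     let: (i, j, K) := s in
     w (i |: K) + w (j |: K) = w (i |: (j |: K)) + w K].

Definition ci_models : set (set (triple n)) :=
  [set M | structural_ci_model M].

End CondIndep.

Arguments ci_models : clear implicits.

Section Objects.
Variables (R : realType) (n : nat).

Definition rank_tests : set {set {set 'S_n}} :=
  [set T | submodular_rank_test R n T].

Definition summand_classes : set (set (set 'rV[R]_n)) :=
  [set normal_class Q | Q in [set Q | minkowski_summand Q (permutohedron R n)]].

Definition cone_faces : set (set (set_function R n)) :=
  [set F | is_face (submodular_cone R n) F /\ F !=set0].

Definition to_rank_test (w : set_function R n) : {set {set 'S_n}} :=
  rank_test (normal_fan (Qpolytope w)).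

Definition to_summand (w : set_function R n) : set (set 'rV[R]_n) :=
  normal_class (Qpolytope w).

End Objects.

Arguments rank_tests : clear implicits.
Arguments summand_classes : clear implicits.
Arguments cone_faces : clear implicits.

(* Main.v *)
(** A nonempty face of a polyhedral cone is determined by the inequalities that
    are tight at a point of its relative interior. The submodular cone is cut out
    by the local inequalities [w (iK) + w (jK) >= w (ijK) + w K], so the smallest
    face containing [w] amounts to the set of CI statements of [w].

    [Q_w] is the convex hull of its greedy vertices, indexed by permutations, and
    two chambers lie in the same maximal cone of its normal fan iff their greedy
    vertices coincide. For permutations that differ by swapping two adjacent
    entries [i], [j] preceded by [K], this coincidence is the CI statement
    [(i, j, K)], so the rank test determines the CI statements. Conversely, if
    those of [w] are among those of [w'], then [w - e w'] is submodular for small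
    [e > 0], and the decomposition [w = (w - e w') + e w'] shows that the normal
    fan of [Q_w] refines that of [Q_w']. The permutohedron is [Q_w] for a [w]
    without CI statements. A summand [Q] of it has, for each chamber, a point
    maximal on the whole chamber, which makes the support function
    [w I = max (e_I . x)] submodular with [Q = Q_w].

    Elementary imsets are the linear forms defining the submodular cone, so
    structural models and CI sets of submodular functions correspond by Farkas'
    lemma. *)

Require Import Defs.
From HB Require Import structures.
From mathcomp Require Import all_boot all_order all_algebra all_fingroup.
From mathcomp Require Import boolp classical_sets functions cardinality reals.
From mathcomp Require Import interval_inference topology normedtype convex.
From mathcomp Require Import ring lra zify.
Import Order.TTheory GRing.Theory Num.Theory.
Import numFieldNormedType.Exports.
Set Implicit Arguments.
Unset Strict Implicit.
Unset Printing Implicit Defensive.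
Local Open Scope classical_set_scope.
Local Open Scope ring_scope.

Definition scalar_of (F : pzRingType) (V : lmodType F) (f : V -> F)
  (lin_f : scalar f) : {scalar V} :=
  HB.pack f (GRing.isLinear.Build F V F *%R f lin_f).

(** * Farkas' lemma and faces of polyhedral cones *)

Section Farkas.
Variables (F : realFieldType) (V : lmodType F).

(* Bartl's induction: when [b] is not bounded by the forms [A (lift ord0 i)], a
   witness [x0] of this has [A ord0 x0 > 0], and projecting along [x0] onto the
   kernel of [A ord0] removes that form. *)
Lemma farkas_ord (m : nat) (A : 'I_m -> {scalar V}) (b : {scalar V}) :
  (forall x, (forall i, A i x <= 0) -> b x <= 0) ->
  exists2 c : 'I_m -> F, forall i, 0 <= c i &
    forall x, b x = \sum_i c i * A i x.
Proof.
elim: m A b => [|m IHm] A b hb.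
  exists (fun=> 0) => // x; rewrite big_ord0.
  apply/eqP; rewrite eq_le hb; last by case.
  by rewrite -oppr_le0 -linearN hb //; case.
have [hb'|] := pselect (forall x, (forall i, A (lift ord0 i) x <= 0) -> b x <= 0).
  have [c c0 bE] := IHm (fun i => A (lift ord0 i)) b hb'.
  exists (fun i => if unlift ord0 i is Some j then c j else 0) => [i|x].
    by case: unlift.
  rewrite big_ord_recl unlift_none mul0r add0r bE.
  by apply: eq_bigr => i _; rewrite liftK.
move=> /existsNP[x0 /not_implyP[Ax0 /negP]]; rewrite -ltNge => bx0.
pose a := A ord0 x0.
have a0 : 0 < a.
  rewrite ltNge; apply/negP => a0.
  suff /hb : forall i, A i x0 <= 0 by rewrite leNgt bx0.
  by move=> i; case: (unliftP ord0 i) => [j|] ->.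
pose proj x := x - (A ord0 x / a) *: x0.
have proj_lin (f : {scalar V}) : scalar (f \o proj).
  by move=> k u v; rewrite /= /proj !(linearB, linearZ, linearD) /=; ring.
have [x projx|c c0 bE] := IHm (fun i => scalar_of (proj_lin (A (lift ord0 i))))
                  (scalar_of (proj_lin b)).
  apply: hb => i; case: (unliftP ord0 i) => [j|] -> //.
    exact: projx.
  by rewrite /proj linearB linearZ /= -/a divfK ?gt_eqF // subrr.
pose d i := c i * A (lift ord0 i) x0.
exists (fun i => if unlift ord0 i is Some j then c j
                 else (b x0 - \sum_i d i) / a) => [i|x].
  case: unlift => [j|]; first exact: c0.
  rewrite divr_ge0 ?(ltW a0) // subr_ge0.
  by rewrite (le_trans _ (ltW bx0)) // sumr_le0 // => j _; rewrite mulr_ge0_le0.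
rewrite big_ord_recl unlift_none.
rewrite [X in _ = _ + X](eq_bigr (fun i => c i * A (lift ord0 i) x)) => [|i _];
  last by rewrite liftK.
have projE (f : {scalar V}) : f (proj x) = f x - A ord0 x / a * f x0.
  by rewrite /proj linearB linearZ.
have := bE x; rewrite /= projE => /eqP; rewrite subr_eq => /eqP ->.
rewrite (eq_bigr (fun i => c i * A (lift ord0 i) x - A ord0 x / a * d i)); last first.
  by move=> i _; rewrite projE /d; ring.
by rewrite sumrB -mulr_sumr; ring.
Qed.

Lemma farkas (I : finType) (A : I -> {scalar V}) (b : {scalar V}) :
  (forall x, (forall i, A i x <= 0) -> b x <= 0) ->
  exists2 c : I -> F, forall i, 0 <= c i & forall x, b x = \sum_i c i * A i x.
Proof.
move=> hb; have [x Ax|c c0 bE] := @farkas_ord #|I| (A \o enum_val) b.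
  by apply: hb => i; rewrite -(enum_rankK i); exact: Ax.
exists (c \o enum_rank) => [i|x]; first exact: c0.
rewrite bE (reindex _ (onW_bij _ (@enum_val_bij I))) /=.
by apply: eq_bigr => i _; rewrite enum_valK.
Qed.

End Farkas.

Section ConeFaces.
Variables (R : realType) (V : lmodType R) (I : finType) (g : I -> {scalar V}).

Definition tight (x : V) : {set I} := [set i | g i x == 0]%SET.

Let C : set V := [set x | forall i, g i x <= 0].

(** The cone contains [2 *: x] and [0], which force [b <= 0] and [0 <= b]. *)
Lemma cone_face_level (l : {scalar V}) (b : R) (x : V) :
  (forall y, C y -> l y <= b) -> C x -> l x = b -> b = 0.
Proof.
move=> lb Cx lx; apply/eqP; rewrite eq_le; apply/andP; split.
  have /lb : C (2 *: x) by move=> i; rewrite linearZ /= pmulr_rle0.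
  by rewrite linearZ /= lx; lra.
by rewrite -(linear0 l) lb // => i; rewrite linear0.
Qed.

(** The sum of the forms tight at [x] is at most 0 on the cone, with equality exactly where each of
    them vanishes. *)
Lemma tight_is_face (x : V) : is_face C [set y | C y /\ tight x \subset tight y].
Proof.
have lin_l : scalar (fun y => \sum_(i in tight x) g i y).
  move=> k u v; rewrite mulr_sumr -big_split /=.
  by apply: eq_bigr => i _; rewrite linearP.
exists (scalar_of lin_l), 0; split=> [y Cy|].
  by apply: sumr_le0 => i _; exact: Cy.
apply/seteqP; split=> y /= [Cy hy]; split=> //.
  apply: big1 => i /(fintype.subsetP hy); rewrite inE => /eqP //.
have /eqP : (\sum_(i in tight x) - g i y) = 0 by rewrite sumrN hy oppr0.
rewrite psumr_eq0; last by move=> i _; rewrite oppr_ge0.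
move=> /allP h; apply/fintype.subsetP => i ix.
by rewrite inE -oppr_eq0; apply: (implyP (h i _)); rewrite ?mem_index_enum.
Qed.

Lemma tight_move (x y : V) : C x -> tight x \subset tight y ->
  exists2 e : R, 0 < e & C (x + e *: (x - y)).
Proof.
(* Forms tight at [x] vanish on [x - y]; the others have slack at least [M] and grow by at most
   [e * N]. The default 1 is for the case that all forms are tight. *)
move=> Cx xy; pose N := \sum_i `|g i (x - y)|.
pose M := \big[Num.min/1]_(i | i \notin tight x) - g i x.
have N0 : 0 <= N by apply: sumr_ge0.
have M0 : 0 < M.
  apply: lt_bigmin => // i; rewrite inE => gx.
  by rewrite oppr_gt0 lt_neqAle gx Cx.
exists (M / (N + 1)) => [|i]; first by rewrite divr_gt0 // ltr_wpDl.
rewrite linearD linearZ /=.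
have [ix|ix] := boolP (i \in tight x).
  have := fintype.subsetP xy i ix; move: ix; rewrite !inE linearB /=.
  by move=> /eqP -> /eqP ->; rewrite subrr mulr0 addr0.
rewrite -lerBrDl sub0r mulrAC ler_pdivrMr ?ltr_wpDl //.
have h1 : M <= - g i x by rewrite /M (bigD1 i) //= ge_min lexx.
have h2 : g i (x - y) <= N.
  rewrite (le_trans (ler_norm _)) // /N (bigD1 i) //= lerDl.
  by apply: sumr_ge0.
by nra.
Qed.

(* The inequality defining [F] is an equality at [x] and holds at the point
   [x + e (x - y)] beyond [x], hence it is an equality at [y]. *)
Lemma tight_sub_face (F : set V) (x y : V) :
  is_face C F -> F x -> C y -> tight x \subset tight y -> F y.
Proof.
move=> [l [b [lb ->]]] /= [Cx lx] Cy xy; split=> //.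
have b0 := cone_face_level lb Cx lx.
have [e e0 Ce] := tight_move Cx xy.
have := lb _ Ce; rewrite linearD linearZ linearB /= lx b0.
move=> h; apply/eqP; rewrite eq_le -{1}b0 lb //=.
by nra.
Qed.

Lemma tightD (x y : V) : C x -> C y -> tight (x + y) = tight x :&: tight y.
Proof.
move=> Cx Cy; apply/setP => i; rewrite !inE linearD /=.
by have := Cx i; have := Cy i => hy hx; apply/eqP/andP => [h|[/eqP-> /eqP->]];
  [split; apply/eqP; lra|rewrite addr0].
Qed.

(** Among the points of [F], [x] is one with the fewest tight forms. For [y] in [F], the point
    [x + y] is in [F] with tight set [tight x :&: tight y], so minimality gives the inclusion. *)
Lemma face_tightE (F : set V) : is_face C F -> F !=set0 ->
  exists2 x, F x & F = [set y | C y /\ tight x \subset tight y].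
Proof.
move=> Fface [x0 Fx0].
have [l [b [lb FE]]] := Fface.
have b0 : b = 0 by move: Fx0; rewrite FE => -[]; apply: cone_face_level.
have : exists k, `[< exists2 x, F x & #|tight x| = k >].
  by exists #|tight x0|; apply/asboolP; exists x0.
move=> /ex_minnP[k /asboolP[x Fx kx] kmin].
exists x => //; apply/seteqP; split=> y.
  move=> Fy; split; first by move: Fy; rewrite FE => -[].
  move: (Fx) (Fy); rewrite FE /= => -[Cx lx] [Cy ly].
  have Fxy : F (x + y).
    rewrite FE /=; split; last by rewrite linearD /= lx ly b0 addr0.
    by move=> i; rewrite linearD /=; have := Cx i; have := Cy i; lra.
  have := kmin #|tight (x + y)|; rewrite -kx (tightD Cx Cy) => kle.
  apply/finset.setIidPl/eqP; rewrite eqEcard finset.subsetIl; apply: kle.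
  by apply/asboolP; exists (x + y) => //; rewrite tightD.
by move=> /= [Cy xy]; exact: tight_sub_face Fface Fx Cy xy.
Qed.

Lemma smallest_tight_face (x : V) : C x ->
  smallest (is_face C) [set x] = [set y | C y /\ tight x \subset tight y].
Proof.
move=> Cx; apply/seteqP; split=> y.
  move=> /(_ _ (conj (tight_is_face x) _)); apply.
  by move=> _ ->.
move=> /= [Cy xy] F [Fface xF].
exact: tight_sub_face Fface (xF x erefl) Cy xy.
Qed.

End ConeFaces.

(** * Normal fans of polytopes *)

Section Polytopes.
Variables (R : realType) (n : nat).
Implicit Types (u v x y : 'rV[R]_n) (Q : set 'rV[R]_n).

Lemma dotC u v : dot u v = dot v u.
Proof. by apply: eq_bigr => i _; rewrite mulrC. Qed.

Lemma dot_is_scalar u : scalar (dot u).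
Proof.
move=> k x y; rewrite /dot mulr_sumr -big_split /=.
by apply: eq_bigr => i _; rewrite !mxE; ring.
Qed.

HB.instance Definition _ u :=
  GRing.isLinear.Build R 'rV[R]_n R *%R (dot u) (@dot_is_scalar u).

Lemma dotDl u v x : dot (u + v) x = dot u x + dot v x.
Proof. by rewrite dotC linearD /= dotC (dotC x v). Qed.

Lemma dotBl u v x : dot (u - v) x = dot u x - dot v x.
Proof. by rewrite dotC linearB /= dotC (dotC x v). Qed.

Lemma dotNl u x : dot (- u) x = - dot u x.
Proof. by rewrite dotC linearN /= dotC. Qed.

Lemma dot0l x : dot (0 : 'rV[R]_n) x = 0.
Proof. by rewrite dotC linear0. Qed.

Lemma dotZl (k : R) u x : dot (k *: u) x = k * dot u x.
Proof. by rewrite dotC linearZ /= dotC. Qed.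

Lemma convex_setP (A : set 'rV[R]_n) : convex_set A <->
  forall x y (t : R), 0 <= t -> t <= 1 -> A x -> A y -> A (t *: x + (1 - t) *: y).
Proof.
split=> [cA x y t t0 t1 Ax Ay|cA x y t].
  by have := cA x y (Itv01 t0 t1); rewrite !inE; apply.
by rewrite !inE => Ax Ay; apply: cA.
Qed.

Lemma conv_hull_sub (S A : set 'rV[R]_n) :
  convex_set A -> S `<=` A -> conv_hull S `<=` A.
Proof. exact: smallest_sub. Qed.

Lemma conv_hull_scalar_le (S : set 'rV[R]_n) (l : {scalar 'rV[R]_n}) (b : R) :
  (forall x, S x -> l x <= b) -> forall x, conv_hull S x -> l x <= b.
Proof.
move=> lS; apply: (@conv_hull_sub S [set x | l x <= b]) => //.
apply/convex_setP => x y t t0 t1 /= lx ly.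
by rewrite linearD !linearZ /=; nra.
Qed.

Lemma convex_set_sum (A : set 'rV[R]_n) (I : finType) (p : I -> 'rV[R]_n)
    (c : I -> R) :
  convex_set A -> (forall i, A (p i)) -> (forall i, 0 <= c i) ->
  \sum_i c i = 1 -> A (\sum_i c i *: p i).
Proof.
move=> /convex_setP cA Ap c0 c1.
(* [x] is the point merged so far and [a] its weight. Weight 0 is allowed, so the fold can start at
   any point of [A]; a vanishing [a + c i] needs its own case. *)
have wsum (s : seq I) (a : R) x : 0 <= a -> A x -> 0 < a + \sum_(i <- s) c i ->
    A ((a + \sum_(i <- s) c i)^-1 *: (a *: x + \sum_(i <- s) c i *: p i)).
  elim: s a x => [|i s IHs] a x a0 Ax.
    rewrite !big_nil !addr0 => a_gt0.
    by rewrite scalerA mulVf ?scale1r ?gt_eqF.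
  rewrite !big_cons !addrA; have [ac0|ac0] := eqVneq (a + c i) 0; last first.
    have ac_gt0 : 0 < a + c i by rewrite lt_neqAle eq_sym ac0 addr_ge0.
    pose y := (a / (a + c i)) *: x + (1 - a / (a + c i)) *: p i.
    have -> : a *: x + c i *: p i = (a + c i) *: y.
      rewrite /y scalerDr !scalerA mulrBr mulr1 mulrC divfK //.
      by rewrite addrAC subrr add0r.
    apply: IHs; first exact: ltW.
    apply: cA => //; first by rewrite divr_ge0 // ltW.
    by rewrite ler_pdivrMr // mul1r lerDl.
  have a_eq0 : a = 0 by have := c0 i; move: a0 ac0; lra.
  have ci0 : c i = 0 by move: ac0; rewrite a_eq0 add0r.
  by rewrite a_eq0 ci0 !scale0r !add0r; have := IHs 0 x; rewrite scale0r !add0r; apply.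
have [i _] : exists i : I, true.
  apply: contrapT => noI; have := c1; rewrite big1 => [/eqP|i _].
    by rewrite eq_sym oner_eq0.
  by case: noI; exists i.
have := wsum (index_enum I) 0 (p i) (lexx _) (Ap i).
by rewrite add0r c1 invr1 scale1r scale0r add0r; apply.
Qed.

Section Generated.
Variables (I : finType) (p : I -> 'rV[R]_n).

Lemma conv_hull_rangeE : conv_hull (range p) =
  [set x | exists c : I -> R,
     [/\ forall i, 0 <= c i, \sum_i c i = 1 & x = \sum_i c i *: p i]].
Proof.
apply/seteqP; split; last first.
  move=> x [c [c0 c1 ->]] A [cA pA]; apply: convex_set_sum => // i.
  by apply: pA; exists i.
apply: conv_hull_sub.
  apply/convex_setP => x y t t0 t1 [c [c0 c1 ->]] [d [d0 d1 ->]].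
  exists (fun i => t * c i + (1 - t) * d i); split=> [i||].
  - by rewrite addr_ge0 // mulr_ge0 ?subr_ge0.
  - by rewrite big_split /= -!mulr_sumr c1 d1; ring.
  - rewrite !scaler_sumr -big_split /=; apply: eq_bigr => i _.
    rewrite !scalerA -scalerDl; reflexivity.
move=> _ [i _ <-]; exists (fun j => (j == i)%:R); split=> [j||].
- by rewrite ler0n.
- by rewrite (bigD1 i) //= eqxx big1 ?addr0 // => j /negPf ->.
- rewrite (bigD1 i) //= eqxx scale1r big1 ?addr0 // => j /negPf ->.
  by rewrite scale0r.
Qed.

(** Farkas' lemma on the pairs [(u, c)], with forms [dot u (p i) - c], yields convex coefficients:
    evaluation at [(0, -1)] shows that they sum to 1, and at unit vectors that they combine the
    [p i] to [z]. *)
Lemma conv_hull_separation z :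
  (forall u c, (forall i, dot u (p i) <= c) -> dot u z <= c) ->
  conv_hull (range p) z.
Proof.
move=> hz; rewrite conv_hull_rangeE.
have lin y : scalar (fun uc : 'rV[R]_n * R^o => dot y uc.1 - uc.2).
  move=> k [u c] [v d] /=; rewrite linearP /=.
  by rewrite /GRing.scale /=; ring.
have [uc hp|c c0 zE] :=
    farkas (A := fun i => scalar_of (lin (p i))) (b := scalar_of (lin z)).
  rewrite /= subr_le0 dotC; apply: hz => i.
  by rewrite dotC -subr_le0; exact: hp.
have c1 : \sum_i c i = 1.
  have := zE (0, -1); rewrite /= linear0 opprK add0r => ->.
  by apply: eq_bigr => i _; rewrite linear0 add0r mulr1.
exists c; split => //; apply/rowP => j.
have := zE (delta_mx 0 j, 0).
have dotE y : dot y (delta_mx 0 j) = y 0 j.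
  rewrite /dot (bigD1 j) //= mxE !eqxx mulr1 big1 ?addr0 // => i /negPf ij.
  by rewrite mxE ij andbF mulr0.
rewrite /= dotE subr0 => ->; rewrite summxE.
by apply: eq_bigr => i _; rewrite /= dotE subr0 mxE.
Qed.

Definition maximizers u : {set I} :=
  [set i | [forall j, dot u (p j) <= dot u (p i)]]%SET.

Lemma maximizersP u i :
  reflect (forall j, dot u (p j) <= dot u (p i)) (i \in maximizers u).
Proof. by rewrite inE; apply: forallP. Qed.

Lemma maximizers_neq0 (i0 : I) u : exists i, i \in maximizers u.
Proof.
exists [arg max_(i > i0) dot u (p i)]%O; apply/maximizersP => j.
by case: arg_maxP => // i _ /(_ j isT).
Qed.

Let Q := conv_hull (range p).

Lemma range_sub_hull i : Q (p i).
Proof. by move=> A [_]; apply; exists i. Qed.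

Lemma max_face_point u i : max_face Q u (p i) <-> i \in maximizers u.
Proof.
split=> [[_ h]|/maximizersP h].
  by apply/maximizersP => j; apply: h; exact: range_sub_hull.
split; first exact: range_sub_hull.
by apply: conv_hull_scalar_le => _ [j _ <-]; exact: h.
Qed.

Lemma max_face_hull (i0 : I) u x : max_face Q u x <->
  Q x /\ forall i, i \in maximizers u -> dot u x = dot u (p i).
Proof.
split=> [[Qx hx]|[Qx hx]]; split=> //.
  move=> i iu; apply/eqP; rewrite eq_le hx; last exact: range_sub_hull.
  by move: iu => /max_face_point[_ ->].
move=> y Qy; have [i iu] := maximizers_neq0 i0 u; rewrite (hx i iu).
by move: iu => /max_face_point[_ ->].
Qed.

End Generated.

(** A description without topology of the cone of the face maximizing [u]; [closure_normal_class]
    identifies it with the closure in [normal_fan]. *)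
Definition normal_cone Q u : set 'rV[R]_n := [set v | max_face Q u `<=` max_face Q v].

(** Points of the face of [u] maximize [u] and [v] at once, so a maximizer of the combination must
    maximize both. *)
Lemma max_face_add Q u v (t : R) : 0 < t -> max_face Q u !=set0 ->
  normal_cone Q u v -> max_face Q (v + t *: u) = max_face Q u.
Proof.
move=> t0 [x0 ux0] uv; have [Qx0 ux0_max] := ux0; have [_ vx0_max] := uv _ ux0.
apply/seteqP; split=> x; last first.
  move=> ux; have [Qx ux_max] := ux; have [_ vx_max] := uv _ ux.
  split=> // y Qy; rewrite !dotDl !dotZl.
  by have := ux_max y Qy; have := vx_max y Qy; nra.
move=> [Qx x_max]; split=> // y Qy; apply: le_trans (ux0_max y Qy) _.
have := x_max x0 Qx0; rewrite !dotDl !dotZl; have := vx0_max x Qx; nra.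
Qed.

(** For fixed [x] and [y] the condition [dot w (y - x) <= 0] is closed in [w], so it passes to the
    closure. Conversely, for [v] in the cone, [v + t *: u] is in the class for all [t > 0] and tends
    to [v]. *)
Lemma closure_normal_class Q u : max_face Q u !=set0 ->
  closure [set v | max_face Q v = max_face Q u] = normal_cone Q u.
Proof.
move=> [x0 [Qx0 ux0]]; apply/seteqP; split=> v.
  move=> cv x ux; split=> [|y Qy]; first by case: ux.
  have cl : closed [set w : 'rV[R]_n | dot w (y - x) <= 0].
    apply: (@preimage_closed _ _ (fun w => dot w (y - x)) [set r | r <= 0]).
      move=> w _; apply: continuous_big => [z|i _].
        by apply: cvgD; [exact: cvg_fst|exact: cvg_snd].
      move=> {}w; have wi := @coord_continuous R 1 n 0 i w.
      exact: (cvgM wi (cvg_cst _)).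
    exact: closed_le.
  move: cv; rewrite closureE => /(_ _ (conj cl _)) /=.
  rewrite linearB /= subr_le0; apply=> w /= wu.
  have [_ /(_ y Qy)] : max_face Q w x by rewrite wu.
  by rewrite linearB /= subr_le0.
move=> uv B vB.
have scale_cont : (v + t *: u) @[t --> (0 : R)] --> v.
  rewrite -[X in _ --> X]addr0 -(scale0r u).
  by apply: cvgD; [exact: cvg_cst|exact: scalel_continuous].
have /nbhs_ballP[e /= e0 eB] := scale_cont B vB.
exists (v + (e / 2) *: u); split; last first.
  by apply: eB; rewrite /ball /= sub0r normrN gtr0_norm; lra.
by apply: max_face_add uv; [lra|exists x0].
Qed.

Lemma normal_fanE Q : (forall u, max_face Q u !=set0) ->
  normal_fan Q = range (normal_cone Q).
Proof.
move=> Q0; apply/seteqP; split=> C [u _ <-]; exists u => //.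
  by rewrite closure_normal_class.
by rewrite closure_normal_class.
Qed.

Section PolytopeFan.
Variables (I : finType) (i0 : I) (p : I -> 'rV[R]_n).
Let Q := conv_hull (range p).

Lemma max_face_neq0 u : max_face Q u !=set0.
Proof.
by have [i iu] := maximizers_neq0 p i0 u; exists (p i); apply/max_face_point.
Qed.

(** A point of the face of [u] is a convex combination in which only maximizers of [u] have positive
    weight, so it maximizes [v] as soon as all of them do. *)
Lemma normal_cone_maximizers u v :
  normal_cone Q u v <-> maximizers p u \subset maximizers p v.
Proof.
split=> [uv|/fintype.subsetP uv x].
  by apply/fintype.subsetP => i /max_face_point/uv/max_face_point.
move=> /(max_face_hull p i0)[Qx ux]; apply/(max_face_hull p i0); split=> //.
have : Q x by [].
rewrite /Q conv_hull_rangeE => -[c [c0 c1 xE]].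
have [k ku] := maximizers_neq0 p i0 u.
have ck i : i \notin maximizers p u -> c i = 0.
  move=> iu; have : \sum_j c j * (dot u (p k) - dot u (p j)) = 0.
    under eq_bigr do rewrite mulrBr.
    rewrite sumrB -mulr_suml c1 mul1r -(ux k ku) xE linear_sum /=.
    by apply/eqP; rewrite subr_eq0; apply/eqP/eq_bigr => j _; rewrite linearZ.
  move=> /eqP; rewrite psumr_eq0 => [/allP/(_ i (mem_index_enum i))|j _].
    rewrite mulf_eq0 subr_eq0 => /orP[/eqP //|/eqP kiE].
    by case/negP: iu; apply/maximizersP => j; rewrite -kiE; apply: (maximizersP _ _ _ ku).
  by rewrite mulr_ge0 // subr_ge0; apply: (maximizersP _ _ _ ku).
move=> j jv; rewrite xE linear_sum /= -[RHS]mul1r -c1 mulr_suml.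
apply: eq_bigr => i _; rewrite linearZ /=.
have [iu|/ck ->] := boolP (i \in maximizers p u); last by rewrite !mul0r.
congr (_ * _); apply/eqP; rewrite eq_le.
by rewrite (maximizersP _ _ _ jv) (maximizersP _ _ _ (uv i iu)).
Qed.

(** Pairs whose first entry does not maximize [u] get the zero form, so that the family is indexed
    by a finite type, as [tight] requires. *)
Let ineq u (ij : I * I) : {scalar 'rV[R]_n} :=
  dot (if ij.1 \in maximizers p u then p ij.2 - p ij.1 else 0).

Lemma normal_cone_ineqE u :
  normal_cone Q u = [set v | forall ij, ineq u ij v <= 0].
Proof.
apply/seteqP; split=> v /=.
  move=> /normal_cone_maximizers/fintype.subsetP uv [i j]; rewrite /ineq /=.
  case: ifP => [iu|_]; last by rewrite dot0l.
  rewrite dotBl !(dotC _ v) subr_le0.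
  exact: (maximizersP _ _ _ (uv i iu)).
move=> uv; apply/normal_cone_maximizers/fintype.subsetP => i iu.
apply/maximizersP => j; have := uv (i, j); rewrite /ineq /= iu.
by rewrite dotBl !(dotC _ v) subr_le0.
Qed.

(** In the cone of [u], a maximizer [i] of [u] also maximizes [v]; hence the pair [(i, j)] is tight
    at [v] iff [j] maximizes [v]. *)
Lemma tight_ineqE u v w : normal_cone Q u v -> normal_cone Q u w ->
  (tight (ineq u) v \subset tight (ineq u) w) =
  (maximizers p v \subset maximizers p w).
Proof.
have tightE x : normal_cone Q u x -> forall i j, i \in maximizers p u ->
    ((i, j) \in tight (ineq u) x) = (j \in maximizers p x).
  move=> /normal_cone_maximizers/fintype.subsetP ux i j iu.
  rewrite inE /ineq /= iu dotBl !(dotC _ x) subr_eq0.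
  have ix := maximizersP _ _ _ (ux i iu).
  apply/eqP/maximizersP => [-> //|jx].
  by apply/eqP; rewrite eq_le ix jx.
move=> uv uw; have [k ku] := maximizers_neq0 p i0 u.
apply/fintype.subsetP/fintype.subsetP => vw => [j jv|[i j]].
  by rewrite -(tightE w uw k j ku) vw ?(tightE v uv).
have [iu|iu] := boolP (i \in maximizers p u).
  by rewrite !tightE //; apply: vw.
by rewrite !inE /ineq /= (negPf iu) !dot0l.
Qed.

Lemma polytope_normal_fan : is_fan (normal_fan Q).
Proof.
rewrite (normal_fanE max_face_neq0); split.
- have -> : range (normal_cone Q) =
      (fun A => [set v | A \subset maximizers p v]) @` range (maximizers p).
    rewrite image_comp; congr (_ @` _); apply/funext => u /=.
    by apply/seteqP; split=> v /normal_cone_maximizers.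
  by apply: finite_image; exact: finite_finset.
- move=> _ [u _ <-].
  exists [seq p ij.2 - p ij.1 | ij <- enum [pred ij : I * I | ij.1 \in maximizers p u]].
  rewrite normal_cone_ineqE; apply/seteqP; split=> v /= uv.
    move=> a /mapP[[i j]] + ->; rewrite mem_enum inE /= => iu.
    by have := uv (i, j); rewrite /ineq /= iu.
  move=> [i j]; rewrite /ineq /=; case: ifP => [iu|_]; last by rewrite dot0l.
  apply: uv.
  by apply/mapP; exists (i, j); rewrite ?mem_enum.
(* A face is cut out by the forms tight at some point [v] of it, and this makes it the cone of
   [v]. *)
- move=> _ D [u _ <-] uD D0.
  have [v Dv DE] : exists2 v, D v & D = [set y | normal_cone Q u y /\
      tight (ineq u) v \subset tight (ineq u) y].
    rewrite normal_cone_ineqE; apply: face_tightE D0.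
    by rewrite -normal_cone_ineqE.
  exists v => //; have uv : normal_cone Q u v by move: Dv; rewrite DE => -[].
  rewrite DE; apply/seteqP; split=> w.
    move=> vw; have uw : normal_cone Q u w by move=> x /uv/vw.
    by split=> //; rewrite tight_ineqE //; exact/normal_cone_maximizers.
  by move=> [uw]; rewrite tight_ineqE // => /normal_cone_maximizers.
have inter u v : is_face (normal_cone Q u) (normal_cone Q u `&` normal_cone Q v).
  have [k ku] := maximizers_neq0 p i0 u.
  (* Every summand is at most 0 on the cone of [u], because [k] is a maximizer there; all vanish
     exactly when the maximizers of [v] are maximizers as well. *)
  exists (dot (\sum_(j in maximizers p v) (p j - p k))), 0.
  have sumE w : dot (\sum_(j in maximizers p v) (p j - p k)) w =
      \sum_(j in maximizers p v) (dot w (p j) - dot w (p k)).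
    by rewrite dotC linear_sum; apply: eq_bigr => j _; rewrite linearB.
  have kmax w : normal_cone Q u w -> forall j, dot w (p j) <= dot w (p k).
    move=> /normal_cone_maximizers/fintype.subsetP uw.
    exact: (maximizersP _ _ _ (uw k ku)).
  split=> [w uw|].
    by rewrite /= sumE; apply: sumr_le0 => j _; rewrite subr_le0 kmax.
  apply/seteqP; split=> w /= [uw].
    move=> /normal_cone_maximizers/fintype.subsetP vw; split=> //.
    rewrite sumE big1 // => j jv; apply/eqP; rewrite subr_eq0 eq_le kmax //=.
    exact: (maximizersP _ _ _ (vw j jv)).
  rewrite sumE => sum0; split=> //; apply/normal_cone_maximizers.
  have /eqP : \sum_(j in maximizers p v) (dot w (p k) - dot w (p j)) = 0.
    apply: (etrans _ (etrans (congr1 -%R sum0) (oppr0 _))); rewrite -sumrN.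
    by apply: eq_bigr => j _; rewrite opprB.
  rewrite psumr_eq0 => [/allP kE|j _]; last by rewrite subr_ge0 kmax.
  apply/fintype.subsetP => j jv; apply/maximizersP => l.
  have := kE j (mem_index_enum j); rewrite jv subr_eq0 => /eqP <-.
  exact: kmax.
by move=> _ _ [u _ <-] [v _ <-]; split; [|rewrite setIC].
Qed.

End PolytopeFan.

End Polytopes.

(** * Greedy vertices of base polytopes *)

Section Greedy.
Variables (R : realType) (n : nat).
Implicit Types (u v x y z : 'rV[R]_n) (w : set_function R n) (d e : 'S_n).

Definition perm_prefix d (k : nat) : {set 'I_n} := [set i | ((d^-1)%g i < k)%N]%SET.

(** Edmonds' greedy vertex: coordinate [i] is the increment of [w] when [i] joins the entries before
    it in [d]. *)
Definition greedy w d : 'rV[R]_n :=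
  \row_i ((w (perm_prefix d ((d^-1)%g i).+1) : R) - w (perm_prefix d ((d^-1)%g i))).

Lemma perm_prefix0 d : perm_prefix d 0 = finset.set0.
Proof. by apply/setP => i; rewrite !inE. Qed.

Lemma perm_prefix_full d k : (n <= k)%N -> perm_prefix d k = [set: 'I_n]%SET.
Proof. by move=> nk; apply/setP => i; rewrite !inE (leq_trans _ nk). Qed.

Lemma sum_prefix_full d k (f : 'I_n -> R) : (n <= k)%N ->
  \sum_(i in perm_prefix d k) f i = \sum_i f i.
Proof. by move=> nk; rewrite perm_prefix_full //; apply: eq_bigl => i; rewrite inE. Qed.

Lemma perm_prefixS d (k : 'I_n) : perm_prefix d k.+1 = d k |: perm_prefix d k.
Proof.
apply/setP => i; rewrite !inE ltnS leq_eqVlt; congr (_ || _).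
by apply/eqP/eqP => [/val_inj <-|->]; rewrite ?permKV ?permK.
Qed.

Lemma perm_prefix_notin d (k : 'I_n) : d k \notin perm_prefix d k.
Proof. by rewrite inE permK ltnn. Qed.

Lemma sum_prefixS d (k : 'I_n) (f : 'I_n -> R) :
  \sum_(i in perm_prefix d k.+1) f i = f (d k) + \sum_(i in perm_prefix d k) f i.
Proof. by rewrite perm_prefixS big_setU1 ?perm_prefix_notin. Qed.

Lemma greedyE w d (k : 'I_n) :
  greedy w d 0 (d k) = w (perm_prefix d k.+1) - w (perm_prefix d k).
Proof. by rewrite mxE permK. Qed.

Lemma perm_prefix_ind d (P : {set 'I_n} -> Prop) : P finset.set0 ->
  (forall k : 'I_n, P (perm_prefix d k) -> P (perm_prefix d k.+1)) ->
  forall k, P (perm_prefix d k).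
Proof.
move=> P0 PS; elim=> [|k IHk]; first by rewrite perm_prefix0.
have [kn|nk] := ltnP k n; first exact: (PS (Ordinal kn)).
by rewrite perm_prefix_full 1?ltnW // -(perm_prefix_full d nk).
Qed.

Lemma greedy_prefix w d k : w finset.set0 = 0 ->
  \sum_(i in perm_prefix d k) greedy w d 0 i = w (perm_prefix d k).
Proof.
move=> w0; move: k.
apply: (@perm_prefix_ind d (fun S => \sum_(i in S) greedy w d 0 i = w S)) => [|k IHk].
  by rewrite finset.big_set0.
by rewrite sum_prefixS IHk greedyE subrK.
Qed.

(** Induction on prefixes: adding an entry [d k] of [I] to [I :&: perm_prefix d k] raises [w] by at
    least the greedy increment, by submodularity for [I :&: perm_prefix d k.+1] and
    [perm_prefix d k]. *)
Lemma greedy_in_Q w d : submodular0 R n w -> Qpolytope w (greedy w d).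
Proof.
move=> [w_sub w0]; split=> [|I _].
  by have := greedy_prefix d n w0; rewrite sum_prefix_full // perm_prefix_full.
suff /(_ n) : forall k,
    \sum_(i in I :&: perm_prefix d k) greedy w d 0 i <= w (I :&: perm_prefix d k).
  by rewrite perm_prefix_full // finset.setIT.
apply: (@perm_prefix_ind d
  (fun S => \sum_(i in I :&: S) greedy w d 0 i <= w (I :&: S))).
  by rewrite finset.setI0 finset.big_set0 w0.
move=> k IHk; have [kI|kI] := boolP (d k \in I); last first.
  suff -> : I :&: perm_prefix d k.+1 = I :&: perm_prefix d k by [].
  apply/setP => i; rewrite perm_prefixS !inE; case: eqP => [->|//].
  by rewrite (negPf kI).
have E : I :&: perm_prefix d k.+1 = d k |: (I :&: perm_prefix d k).
  rewrite perm_prefixS finset.setIUr; congr (_ :|: _).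
  by apply/finset.setIidPr; rewrite finset.sub1set.
have -> : \sum_(i in I :&: perm_prefix d k.+1) greedy w d 0 i =
    greedy w d 0 (d k) + \sum_(i in I :&: perm_prefix d k) greedy w d 0 i.
  by rewrite E big_setU1 //= inE negb_and perm_prefix_notin orbT.
rewrite greedyE; have := w_sub (I :&: perm_prefix d k.+1) (perm_prefix d k).
have -> : I :&: perm_prefix d k.+1 :&: perm_prefix d k = I :&: perm_prefix d k.
  by apply/setP => i; rewrite perm_prefixS !inE; case: (_ < _)%N; rewrite ?orbT ?andbF ?andbT.
have -> : I :&: perm_prefix d k.+1 :|: perm_prefix d k = perm_prefix d k.+1.
  apply/setP => i; rewrite perm_prefixS !inE.
  by case: eqP => [->|_]; rewrite ?kI //=; case: (_ \in I); case: (_ < _)%N.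
by move: IHk; lra.
Qed.

Lemma abel_sum (a B : nat -> R) m :
  \sum_(k < m) a k * (B k.+1 - B k) =
  a m * B m - a 0 * B 0 + \sum_(k < m) (a k - a k.+1) * B k.+1.
Proof.
elim: m => [|m IHm]; first by rewrite !big_ord0; ring.
by rewrite !big_ord_recr /= IHm; ring.
Qed.

Lemma dot_prefix d u z : \sum_i z 0 i = 0 ->
  exists a : nat -> R, (forall k : 'I_n, a k = u 0 (d k)) /\
  dot u z = \sum_(k < n) (a k - a k.+1) * \sum_(i in perm_prefix d k.+1) z 0 i.
Proof.
(* Beyond the last position [a] takes the default 0, which only ever multiplies the total
   [B n = 0]. *)
move=> z0; pose a k := oapp (fun i : 'I_n => u 0 (d i)) 0 (insub k).
exists a; split=> [k|]; first by rewrite /a valK.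
pose B k := \sum_(i in perm_prefix d k) z 0 i.
have := abel_sum a B n.
have -> : B n = 0.
  by rewrite /B sum_prefix_full.
have -> : B 0 = 0 by rewrite /B perm_prefix0 finset.big_set0.
rewrite !mulr0 subrr add0r => <-.
rewrite /dot (reindex_inj (@perm_inj _ d)) /=; apply: eq_bigr => k _.
by rewrite /B sum_prefixS addrK /a valK.
Qed.

(** Summation by parts along [d] expresses [dot u (y - x)] by prefix sums of [y - x], with
    coefficients that are nonnegative on the chamber; the last one, of unknown sign, goes with the
    total 0. *)
Lemma dot_le_chamber d u x y : chamber d u ->
  \sum_i x 0 i = \sum_i y 0 i ->
  (forall k, \sum_(i in perm_prefix d k) x 0 i <= \sum_(i in perm_prefix d k) y 0 i) ->
  dot u x <= dot u y.
Proof.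
move=> du xy xy_le; have z0 : \sum_i (y - x) 0 i = 0.
  by under eq_bigr do rewrite !mxE; rewrite sumrB xy subrr.
have [a [aE]] := dot_prefix d u z0.
rewrite linearB /= -subr_ge0 => ->; apply: sumr_ge0 => k _.
have [kn|nk] := ltnP k.+1 n; last first.
  by rewrite sum_prefix_full // z0 mulr0.
rewrite mulr_ge0 //.
  by rewrite (aE k) (aE (Ordinal kn)) subr_ge0; apply: du.
by under eq_bigr do rewrite !mxE; rewrite sumrB subr_ge0.
Qed.

(** A point in the interior of the chamber of [d]: its coordinates drop by exactly 1 along [d]. *)
Definition generic d : 'rV[R]_n := \row_i - ((d^-1)%g i)%:R.

Lemma generic_chamber d : chamber d (generic d).
Proof. by move=> i j ij; rewrite !mxE !permK lerN2 ler_nat. Qed.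

(** Here the coefficients in the summation by parts, except the last, equal 1, so all prefix sums of
    [y - x] vanish, and with them all coordinates. *)
Lemma dot_eq_generic d x y :
  \sum_i x 0 i = \sum_i y 0 i ->
  (forall k, \sum_(i in perm_prefix d k) x 0 i <= \sum_(i in perm_prefix d k) y 0 i) ->
  dot (generic d) x = dot (generic d) y -> x = y.
Proof.
move=> xy xy_le dxy.
have zE S : \sum_(i in S) (y - x) 0 i = \sum_(i in S) y 0 i - \sum_(i in S) x 0 i.
  by under eq_bigr do rewrite !mxE; rewrite sumrB.
have z0 : \sum_i (y - x) 0 i = 0.
  by under eq_bigr do rewrite !mxE; rewrite sumrB xy subrr.
have B0 : forall k, \sum_(i in perm_prefix d k) (y - x) 0 i = 0.
  move=> [|k]; first by rewrite perm_prefix0 finset.big_set0.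
  have Bn m : (n <= m)%N -> \sum_(i in perm_prefix d m) (y - x) 0 i = 0.
    by move=> nm; rewrite sum_prefix_full.
  have [kn|] := ltnP k.+1 n; last exact: Bn.
  have [a [aE]] := dot_prefix d (generic d) z0.
  rewrite linearB /= dxy subrr => /esym/eqP; rewrite psumr_eq0 => [/allP|j _].
    move=> /(_ (Ordinal (ltnW kn)) (mem_index_enum _)) /=.
    rewrite mulf_eq0 => /orP[|/eqP //].
    rewrite (aE (Ordinal (ltnW kn))) (aE (Ordinal kn)) !mxE !permK /= -natr1.
    by move=> /eqP; lra.
  have [jn|nj] := ltnP j.+1 n; last by rewrite Bn ?mulr0.
  rewrite zE mulr_ge0 ?subr_ge0 // (aE j) (aE (Ordinal jn)).
  by apply: generic_chamber.
apply/esym/subr0_eq/rowP => i; rewrite [RHS]mxE -(permKV d i).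
have := sum_prefixS d ((d^-1)%g i) (fun i => (y - x) 0 i).
by rewrite !B0 addr0.
Qed.

Lemma chamber_exists u : exists d, chamber d u.
Proof.
pose le_u (i j : 'I_n) := u 0 j <= u 0 i.
have : perm_eq (sort le_u (ord_tuple n)) (ord_tuple n) by rewrite perm_sort.
move=> /tuple_permP[d dE]; exists d => i j.
have srt : sorted le_u (sort le_u (ord_tuple n)).
  by apply: sort_sorted => k l; rewrite /le_u le_total.
have le_u_trans : transitive le_u by move=> k l m; rewrite /le_u => kl /le_trans; apply.
have nthE (k : 'I_n) : nth k (sort le_u (ord_tuple n)) k = d k.
  by rewrite dE -tnth_nth tnth_mktuple tnth_ord_tuple.
have size_s : size (sort le_u (ord_tuple n)) = n by rewrite size_sort size_tuple.
rewrite leq_eqVlt => /orP[/eqP/val_inj -> //|ij].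
have := sorted_ltn_nth le_u_trans i srt.
move=> /(_ i j); rewrite !inE size_s => /(_ _ _ ij).
rewrite nthE (set_nth_default j) ?size_s // nthE /le_u.
by apply; apply: ltn_ord.
Qed.

End Greedy.

Section BasePolytope.
Variables (R : realType) (n : nat) (w : set_function R n).
Hypothesis w_sub : submodular0 R n w.
Implicit Types (u v x y z : 'rV[R]_n) (d e : 'S_n).

Lemma Q_prefix_le x d k : Qpolytope w x ->
  \sum_(i in perm_prefix d k) x 0 i <= \sum_(i in perm_prefix d k) greedy w d 0 i.
Proof.
move=> [xT xI]; rewrite greedy_prefix; last by case: w_sub.
have [->|] := eqVneq (perm_prefix d k) finset.set0; last exact: xI.
by rewrite finset.big_set0 (proj2 w_sub).
Qed.

Lemma Q_sum x y : Qpolytope w x -> Qpolytope w y -> \sum_i x 0 i = \sum_i y 0 i.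
Proof. by move=> [-> _] [-> _]. Qed.

Lemma Q_dot_le x d u : Qpolytope w x -> chamber d u -> dot u x <= dot u (greedy w d).
Proof.
move=> Qx du; apply: (dot_le_chamber du) => [|k]; last exact: Q_prefix_le.
by apply: Q_sum => //; apply: greedy_in_Q.
Qed.

Lemma Q_dot_generic x d : Qpolytope w x ->
  dot (generic R d) x = dot (generic R d) (greedy w d) -> x = greedy w d.
Proof.
move=> Qx; apply: dot_eq_generic => [|k]; last exact: Q_prefix_le.
by apply: Q_sum => //; apply: greedy_in_Q.
Qed.

Lemma Q_convex : convex_set (Qpolytope w).
Proof.
apply/convex_setP => x y t t0 t1 [xT xI] [yT yI].
have sumE (S : {set 'I_n}) : \sum_(i in S) (t *: x + (1 - t) *: y) 0 i =
    t * \sum_(i in S) x 0 i + (1 - t) * \sum_(i in S) y 0 i.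
  by rewrite !mulr_sumr -big_split /=; apply: eq_bigr => i _; rewrite !mxE.
split=> [|I I0].
  have := sumE [set: 'I_n]%SET.
  under eq_bigl do rewrite inE.
  move=> ->; under eq_bigl do rewrite inE.
  rewrite xT; under eq_bigl do rewrite inE.
  by rewrite yT; ring.
by rewrite sumE; have := xI I I0; have := yI I I0; nra.
Qed.

Lemma Q_hull : Qpolytope w = conv_hull (range (greedy w)).
Proof.
apply/seteqP; split=> x.
  move=> Qx; apply: conv_hull_separation => u c uc.
  by have [d du] := chamber_exists u; apply: le_trans (uc d); apply: Q_dot_le.
apply: conv_hull_sub; first exact: Q_convex.
by move=> _ [d _ <-]; apply: greedy_in_Q.
Qed.

End BasePolytope.

(** * Faces of the submodular cone and conditional independence *)

Section LocalSubmodularity.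
Variables (F : realFieldType) (n : nat).
Implicit Types (w : set_function F n) (s : triple n).

(** The sign turns submodularity into [<= 0], the convention used for cone faces. Triples that are
    not CI statements get the form 0, which lets a finite type index the family. *)
Definition elementary_form s w : F :=
  let: (i, j, K) := s in
  if is_ci s then w (i |: (j |: K)) + w K - w (i |: K) - w (j |: K) else 0.

Lemma elementary_form_is_scalar s : scalar (elementary_form s).
Proof.
move: s => [[i j] K] k v w; rewrite /elementary_form; case: ifP => _; last by ring.
by rewrite !ffunE /GRing.scale /=; ring.
Qed.

HB.instance Definition _ s := GRing.isLinear.Build F {ffun {set 'I_n} -> F^o} F *%R
  (elementary_form s) (@elementary_form_is_scalar s).

Lemma elementary_form_not_ci s w : ~~ is_ci s -> elementary_form s w = 0.
Proof. by case: s => [[i j] K] sci; rewrite /elementary_form (negPf sci). Qed.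

(** Diminishing returns for one element [i] follow by enlarging [A] to [B] one element at a time;
    adding the elements of [D] one at a time extends this to sets, and [A = I :&: J], [B = J],
    [D = I :\: J] is the claim. *)
Lemma submodular_local w : (forall s, elementary_form s w <= 0) ->
  forall I J : {set 'I_n}, (w (I :&: J) : F) + w (I :|: J) <= w I + w J.
Proof.
move=> w_loc.
have diminishing m (A B : {set 'I_n}) i : (#|B :\: A| <= m)%N -> A \subset B ->
    i \notin B -> (w (i |: B) : F) + w A <= w (i |: A) + w B.
  elim: m B => [|m IHm] B BA_m AB iB.
    have -> : B = A; last by rewrite addrC.
    apply/eqP; rewrite finset.eqEsubset AB -finset.setD_eq0 -cards_eq0.
    by rewrite -leqn0 BA_m.
  have [BA|] := eqVneq (B :\: A) finset.set0.
    have -> : B = A; last by rewrite addrC.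
    by apply/eqP; rewrite finset.eqEsubset AB -finset.setD_eq0 BA eqxx.
  move=> /set0Pn[j]; rewrite inE => /andP[jA jB].
  have BE : B = j |: (B :\ j) by rewrite finset.setD1K.
  have iBj : i \notin B :\ j by rewrite !inE negb_and iB orbT.
  have cardBj : (#|(B :\ j) :\: A| <= m)%N.
    rewrite -ltnS (leq_trans _ BA_m) // proper_card //.
    apply/properP; split; first by rewrite finset.setSD // finset.subD1set.
    by exists j; rewrite !inE ?eqxx ?andbF // jA jB.
  have ABj : A \subset B :\ j by rewrite finset.subsetD1 AB.
  have := IHm _ cardBj ABj iBj.
  have := w_loc (i, j, B :\ j); rewrite /elementary_form /is_ci iBj !inE eqxx /=.
  have -> : i != j by apply: contraNneq iB => ->.
  rewrite -BE /=; lra.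
have union m (A B D : {set 'I_n}) : (#|D| <= m)%N -> A \subset B ->
    D :&: B = finset.set0 -> (w (D :|: B) : F) + w A <= w (D :|: A) + w B.
  elim: m D => [|m IHm] D Dm AB DB.
    have -> : D = finset.set0 by apply/eqP; rewrite -cards_eq0 -leqn0.
    by rewrite !finset.set0U addrC.
  have [->|/set0Pn[i iD]] := eqVneq D finset.set0; first by rewrite !finset.set0U addrC.
  have DE : D = i |: (D :\ i) by rewrite finset.setD1K.
  have iB : i \notin B by move/setP/(_ i): DB; rewrite !inE iD => /= ->.
  have DiB : (D :\ i) :&: B = finset.set0.
    by rewrite finset.setIC finset.setIDA finset.setIC DB finset.set0D.
  have Dim : (#|D :\ i| <= m)%N.
    by rewrite -ltnS (leq_trans _ Dm) // [X in (_ < X)%N](cardsD1 i) iD.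
  have := IHm _ Dim AB DiB.
  have := @diminishing _ ((D :\ i) :|: A) ((D :\ i) :|: B) i (leqnn _).
  rewrite !finset.setUA -DE finset.setUS // !inE eqxx (negPf iB) => /(_ isT isT).
  lra.
move=> I J; have := @union #|I :\: J| (I :&: J) J (I :\: J) (leqnn _).
rewrite finset.subsetIr => /(_ isT).
have -> : (I :\: J) :|: J = I :|: J.
  by apply/setP => i; rewrite !inE; case: (i \in J); rewrite ?orbT ?orbF.
have -> : (I :\: J) :|: (I :&: J) = I by rewrite finset.setUC finset.setID.
have -> : (I :\: J) :&: J = finset.set0.
  by apply/setP => i; rewrite !inE; case: (i \in J); rewrite ?andbF.
by move=> /(_ erefl); lra.
Qed.
End LocalSubmodularity.

(** * CI statements, normal fans and rank tests *)

Section ConditionalIndependence.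
Variables (R : realType) (n : nat).
Implicit Types (w : set_function R n) (s : triple n) (d : 'S_n) (u v x : 'rV[R]_n).

Lemma elementary_form_le0 w : submodular w <-> forall s, elementary_form s w <= 0.
Proof.
split=> [w_sub [[i j] K]|w_loc I J]; last exact: submodular_local.
rewrite /elementary_form; case: ifP => // /and3P[ij iK jK].
have := w_sub (i |: K) (j |: K).
have -> : (i |: K) :&: (j |: K) = K.
  apply/setP => l; rewrite !inE; have [->|_] := eqVneq l i; last by rewrite orKb.
  by rewrite (negPf ij) (negPf iK).
have -> : (i |: K) :|: (j |: K) = i |: (j |: K).
  by apply/setP => l; rewrite !inE; case: (l \in K); rewrite ?orbT ?orbF.
lra.
Qed.

Lemma submodular_coneE :
  submodular_cone R n = [set w | forall s, elementary_form s w <= 0].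
Proof. by apply/seteqP; split=> w /elementary_form_le0. Qed.

Lemma ci_ofE w s : ci_of w s <-> is_ci s /\ elementary_form s w = 0.
Proof.
move: s => [[i j] K]; rewrite /ci_of /elementary_form /=.
split=> -[sci]; rewrite ?sci => h; split=> //; rewrite ?sci //.
  by move: h; lra.
by move: h; lra.
Qed.

Lemma ci_of_tight w w' : ci_of w `<=` ci_of w' <->
  tight (@elementary_form R n) w \subset tight (@elementary_form R n) w'.
Proof.
split=> [ww'|/fintype.subsetP ww' s /ci_ofE[sci sw]].
  apply/fintype.subsetP => s; rewrite !inE => /eqP sw.
  have [sci|sci] := boolP (is_ci s).
    by apply/eqP; apply: (proj2 (proj1 (ci_ofE w' s) (ww' s _))); apply/ci_ofE.
  by rewrite /= elementary_form_not_ci.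
apply/ci_ofE; split=> //.
by have := ww' s; rewrite !inE /= sw eqxx => /(_ isT)/eqP.
Qed.

Lemma smallest_face_tight w : submodular w ->
  smallest_face w = [set w' | (forall s, elementary_form s w' <= 0) /\
    tight (@elementary_form R n) w \subset tight (@elementary_form R n) w'].
Proof.
move=> /elementary_form_le0 w_loc; rewrite /smallest_face submodular_coneE.
exact: (smallest_tight_face (g := @elementary_form R n)).
Qed.

Lemma smallest_faceE w : submodular w ->
  smallest_face w = [set w' | submodular w' /\ ci_of w `<=` ci_of w'].
Proof.
move=> w_sub; rewrite smallest_face_tight //.
by apply/seteqP; split=> w' [w'_sub /ci_of_tight]; split=> //; apply/elementary_form_le0.
Qed.

Lemma ci_of_sub_move w w' : submodular0 R n w -> submodular0 R n w' ->
  ci_of w `<=` ci_of w' -> exists2 e : R, 0 < e & submodular0 R n (w - e *: w').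
Proof.
move=> [w_sub w0] [w'_sub w'0] ww'.
(* The choice [y := w + w'] makes [x - y] equal to [- w'], so moving beyond [x] subtracts a multiple
   of [w']. *)
have [||e e0 he] := tight_move (g := @elementary_form R n) (x := w) (y := w + w').
- exact/elementary_form_le0.
- move/ci_of_tight/fintype.subsetP: ww' => ww'; apply/fintype.subsetP => s sw.
  have := ww' s sw; move: sw; rewrite !inE linearD /= => /eqP-> /eqP->.
  by rewrite addr0.
exists e => //; split.
  by apply/elementary_form_le0; move: he; rewrite opprD addrA subrr add0r scalerN.
by rewrite !ffunE w0 w'0 scaler0 subr0.
Qed.

Lemma greedy_lin w w' d (e : R) : greedy (w + e *: w') d = greedy w d + e *: greedy w' d.
Proof. by apply/rowP => i; rewrite !mxE !ffunE /GRing.scale /=; ring. Qed.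

Lemma max_face_QE w d u x : submodular0 R n w -> chamber d u ->
  max_face (Qpolytope w) u x <-> Qpolytope w x /\ dot u x = dot u (greedy w d).
Proof.
move=> w_sub du; split=> [[Qx x_max]|[Qx xE]]; split=> //.
  by apply/eqP; rewrite eq_le (Q_dot_le w_sub Qx du) x_max //; apply: greedy_in_Q.
by move=> y Qy; rewrite xE; apply: Q_dot_le.
Qed.

Lemma greedy_max_face w d u : submodular0 R n w -> chamber d u ->
  max_face (Qpolytope w) u (greedy w d).
Proof.
by move=> w_sub du; apply/(max_face_QE _ w_sub du); split=> //; exact: greedy_in_Q.
Qed.

(* [w = (w - e w') + e w'], so a maximizer over [Q_w'] is completed by one over
   [Q_(w - e w')] to a maximizer over [Q_w]. *)
Lemma ci_of_normal_cone w w' u : submodular0 R n w -> submodular0 R n w' ->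
  ci_of w `<=` ci_of w' -> normal_cone (Qpolytope w) u `<=` normal_cone (Qpolytope w') u.
Proof.
move=> w_sub w'_sub ww' v uv y; have [e e0 z_sub] := ci_of_sub_move w_sub w'_sub ww'.
set w'' := w - e *: w' in z_sub; have wE : w = w'' + e *: w' by rewrite subrK.
have [d du] := chamber_exists u; have [f fv] := chamber_exists v.
move=> /(max_face_QE _ w'_sub du)[Qy uy].
apply/(max_face_QE _ w'_sub fv); split=> //.
have Qz := greedy_in_Q d z_sub; set z := greedy w'' d in Qz.
have Qzy : Qpolytope w (z + e *: y).
  have sumE (S : {set 'I_n}) : \sum_(i in S) (z + e *: y) 0 i =
      \sum_(i in S) z 0 i + e * \sum_(i in S) y 0 i.
    by rewrite mulr_sumr -big_split /=; apply: eq_bigr => i _; rewrite !mxE.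
  have [zT zI] := Qz; have [yT yI] := Qy.
  have wI I : w I = (w'' I : R) + e * w' I by rewrite wE !ffunE.
  split=> [|I I0]; last first.
    by rewrite sumE wI; have := zI I I0; have := yI I I0; nra.
  have := sumE [set: 'I_n]%SET.
  have sumT (x : 'rV[R]_n) : \sum_(i in [set: 'I_n]%SET) x 0 i = \sum_i x 0 i.
    by apply: eq_bigl => i; rewrite inE.
  by rewrite !sumT zT yT -wI.
have : max_face (Qpolytope w) u (z + e *: y).
  apply/(max_face_QE _ w_sub du); split=> //.
  by rewrite wE greedy_lin !linearD !linearZ /= uy.
move=> /uv/(max_face_QE _ w_sub fv)[_].
rewrite [in RHS]wE greedy_lin !linearD !linearZ /= => vE.
have vz := Q_dot_le z_sub Qz fv; have vy := Q_dot_le w'_sub Qy fv.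
by apply/eqP; rewrite eq_le vy /=; nra.
Qed.

Lemma Q_max_face_neq0 w u : submodular0 R n w -> max_face (Qpolytope w) u !=set0.
Proof.
move=> w_sub; have [d du] := chamber_exists u.
by exists (greedy w d); exact: greedy_max_face.
Qed.

Lemma Q_normal_fanE w : submodular0 R n w ->
  normal_fan (Qpolytope w) = range (normal_cone (Qpolytope w)).
Proof. by move=> w_sub; apply: normal_fanE => u; exact: Q_max_face_neq0. Qed.

Lemma ci_of_refines w w' : submodular0 R n w -> submodular0 R n w' ->
  ci_of w `<=` ci_of w' -> refines (normal_fan (Qpolytope w)) (normal_fan (Qpolytope w')).
Proof.
move=> w_sub w'_sub ww' C; rewrite !Q_normal_fanE // => -[u _ <-].
by exists (normal_cone (Qpolytope w') u); [exists u|exact: ci_of_normal_cone].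
Qed.

Lemma ci_of_normal_fan w w' : submodular0 R n w -> submodular0 R n w' ->
  ci_of w = ci_of w' -> normal_fan (Qpolytope w) = normal_fan (Qpolytope w').
Proof.
move=> w_sub w'_sub ww'; rewrite !Q_normal_fanE //.
suff -> : normal_cone (Qpolytope w) = normal_cone (Qpolytope w') by [].
apply/funext => u; apply/seteqP.
by split; apply: ci_of_normal_cone => //; rewrite ww'.
Qed.

Lemma max_face_generic w d : submodular0 R n w ->
  max_face (Qpolytope w) (generic R d) = [set greedy w d].
Proof.
move=> w_sub; have dd := generic_chamber R d.
apply/seteqP; split=> x /=; last by move=> ->; exact: greedy_max_face.
by move=> /(max_face_QE _ w_sub dd)[Qx]; exact: Q_dot_generic.
Qed.

Lemma chamber_normal_cone w d : submodular0 R n w ->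
  chamber d `<=` normal_cone (Qpolytope w) (generic R d).
Proof.
by move=> w_sub u du x; rewrite max_face_generic // => ->; exact: greedy_max_face.
Qed.

(** At [generic R d] only [greedy w d] is maximal. If the cone of [u] contains the chambers of [d]
    and [d'], the nonempty face of [u] therefore consists of [greedy w d] and of [greedy w d'].
    Conversely, the cone of a direction with a single maximizer is maximal. *)
Lemma same_classE w d d' : submodular0 R n w ->
  same_class (normal_fan (Qpolytope w)) d d' <-> greedy w d = greedy w d'.
Proof.
move=> w_sub; rewrite /same_class Q_normal_fanE //; split.
  move=> [_ [[[u _ <-] _] du d'u]].
  have gd : max_face (Qpolytope w) u (greedy w d).
    have [x ux] := Q_max_face_neq0 u w_sub.
    by have := du _ (generic_chamber R d) x ux; rewrite max_face_generic // => <-.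
  by have := d'u _ (generic_chamber R d') _ gd; rewrite max_face_generic.
move=> dd'; exists (normal_cone (Qpolytope w) (generic R d)); split.
- split; first by exists (generic R d).
  move=> _ [u _ <-] du; apply/seteqP; split=> // v uv x.
  have ud : normal_cone (Qpolytope w) u (generic R d) by apply: du => x'.
  rewrite max_face_generic // => ->.
  have [y uy] := Q_max_face_neq0 u w_sub.
  by have := ud y uy; rewrite max_face_generic // => <-; exact: uv.
- exact: chamber_normal_cone.
- have := @chamber_normal_cone w d' w_sub.
  by rewrite /normal_cone !max_face_generic // dd'.
Qed.

(** The permutations with the same greedy vertex as [d] form its block in the rank test, so equal
    partitions give equal relations. *)
Lemma rank_test_greedy w w' d d' : submodular0 R n w -> submodular0 R n w' ->
  to_rank_test w = to_rank_test w' ->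
  greedy w d = greedy w d' <-> greedy w' d = greedy w' d'.
Proof.
have relE w0 : submodular0 R n w0 ->
    (fun d d' => `[< same_class (normal_fan (Qpolytope w0)) d d' >]) =
    (fun d d' => greedy w0 d == greedy w0 d').
  move=> w0_sub; apply/funext => e; apply/funext => e'.
  by apply/asboolP/eqP => /same_classE; apply.
have blockE w0 : submodular0 R n w0 ->
    (d' \in finset.pblock (to_rank_test w0) d) = (greedy w0 d == greedy w0 d').
  move=> w0_sub; rewrite /to_rank_test /rank_test relE //.
  rewrite pblock_equivalence_partition ?inE //.
  by move=> e1 e2 e3 _ _ _; split=> // /eqP ->.
move=> w_sub w'_sub ww'; have := blockE w w_sub; rewrite ww' (blockE w' w'_sub).
by move=> E; split=> /eqP; [rewrite -E|rewrite E] => /eqP.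
Qed.

End ConditionalIndependence.

(** * Exchanging adjacent entries of a permutation *)

Section Swap.
Variables (R : realType) (n : nat).
Implicit Types (i j k l : 'I_n) (K : {set 'I_n}) (d : 'S_n).

(** The permutation [d] lists [K], then [i], then [j], and [d'] exchanges the last two. Their
    prefixes differ only between [i] and [j], so the greedy vertices differ at most in these two
    coordinates, where equality is the CI statement. *)
Lemma greedy_adjacent i j K : is_ci (i, j, K) -> exists d d' : 'S_n,
  forall w : set_function R n, greedy w d = greedy w d' <-> ci_of w (i, j, K).
Proof.
move=> sci; have /and3P[ij iK jK] := sci.
(* Sorting by decreasing [c] puts [K] first, then [i], then [j]. *)
pose c l : nat := (if l \in K then 3 else if l == i then 2 else l == j)%N.
have [d dc] : exists d : 'S_n, forall l m, (c m < c l)%N -> ((d^-1)%g l < (d^-1)%g m)%N.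
  have [d dc] := @chamber_exists R n (\row_l (c l)%:R).
  exists d => l m; rewrite !ltnNge; apply: contra => /dc.
  by rewrite !mxE !permKV ler_nat.
have cK l : l \in K -> c l = 3%N by rewrite /c => ->.
have ci : c i = 2%N by rewrite /c (negPf iK) eqxx.
have cj : c j = 1%N by rewrite /c (negPf jK) eq_sym (negPf ij) eqxx.
have cn l : l \notin K -> l != i -> l != j -> c l = 0%N.
  by rewrite /c => /negPf -> /negPf -> /negPf ->.
have Ki : perm_prefix d ((d^-1)%g i) = K.
  apply/setP => l; rewrite inE; have [lK|lK] := boolP (l \in K).
    by rewrite dc // ci cK.
  apply/negbTE; rewrite -leqNgt; have [->//|li] := eqVneq l i.
  have [->|lj] := eqVneq l j; first by rewrite ltnW // dc // ci cj.
  by rewrite ltnW // dc // ci cn.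
have KiS : perm_prefix d ((d^-1)%g i).+1 = i |: K by rewrite perm_prefixS permKV Ki.
have Kj : perm_prefix d ((d^-1)%g j) = i |: K.
  rewrite -KiS; apply/setP => l; rewrite !inE ltnS.
  have [lK|lK] := boolP (l \in K).
    by rewrite dc ?cj ?cK // ltnW // dc // ci cK.
  have [->|li] := eqVneq l i; first by rewrite leqnn dc // ci cj.
  have [->|lj] := eqVneq l j; first by rewrite ltnn leqNgt dc // ci cj.
  by rewrite ltnNge ltnW ?dc ?cj ?cn // leqNgt dc // ci cn.
have KjS : perm_prefix d ((d^-1)%g j).+1 = i |: (j |: K).
  by rewrite perm_prefixS permKV Kj finset.setUCA.
exists d, (d * tperm i j)%g => w.
have d'E l : ((d * tperm i j)^-1)%g l = (d^-1)%g (tperm i j l).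
  by rewrite invMg permM tpermV.
(* Only prefixes containing exactly one of [i] and [j] are changed by the exchange. *)
have prefixE (k : nat) : (i \in perm_prefix d k) = (j \in perm_prefix d k) ->
    perm_prefix (d * tperm i j)%g k = perm_prefix d k.
  move=> ijk; apply/setP => l; rewrite inE d'E; case: tpermP => [->|->|_ _].
  - by have := ijk; rewrite !inE => <-.
  - by have := ijk; rewrite !inE => <-.
  - by rewrite inE.
have Kj' : perm_prefix (d * tperm i j)%g ((d^-1)%g i) = K.
  by rewrite prefixE Ki // (negPf iK) (negPf jK).
have KjS' : perm_prefix (d * tperm i j)%g ((d^-1)%g i).+1 = j |: K.
  by rewrite perm_prefixS permM permKV tpermL Kj'.
have Ki' : perm_prefix (d * tperm i j)%g ((d^-1)%g j) = j |: K.
  apply/setP => l; rewrite inE d'E.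
  have := congr1 (fun S : {set 'I_n} => tperm i j l \in S) Kj.
  rewrite /= !inE => ->; case: tpermP => [->|->|/eqP/negPf-> /eqP/negPf->].
  - by rewrite (negPf iK) (negPf jK) !orbF eq_sym.
  - by rewrite !eqxx.
  - by [].
have KiS' : perm_prefix (d * tperm i j)%g ((d^-1)%g j).+1 = i |: (j |: K).
  by rewrite perm_prefixS permM permKV tpermR Ki'.
have gi : greedy w d 0 i = w (i |: K) - w K by rewrite mxE Ki KiS.
have gj : greedy w d 0 j = w (i |: (j |: K)) - w (i |: K) by rewrite mxE Kj KjS.
have gi' : greedy w (d * tperm i j)%g 0 i = w (i |: (j |: K)) - w (j |: K).
  by rewrite mxE d'E tpermL Ki' KiS'.
have gj' : greedy w (d * tperm i j)%g 0 j = w (j |: K) - w K.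
  by rewrite mxE d'E tpermR Kj' KjS'.
rewrite /ci_of /=; split=> [gE|[_ wE]].
  by split=> //; have := gi'; rewrite -gE gi; lra.
apply/rowP => l; have [->|li] := eqVneq l i; first by rewrite gi gi'; lra.
have [->|lj] := eqVneq l j; first by rewrite gj gj'; lra.
rewrite !mxE d'E tpermD 1?eq_sym //.
have pos_neq m : l != m -> ((d^-1)%g l == (d^-1)%g m :> nat) = false.
  by move=> lm; apply/negbTE; apply: contra lm => /eqP/val_inj/perm_inj ->.
have lt_i_l : ((d^-1)%g i < (d^-1)%g l)%N = (l \notin K).
  by rewrite ltnNge leq_eqVlt pos_neq // -Ki inE.
have lt_j_l : ((d^-1)%g j < (d^-1)%g l)%N = (l \notin K).
  have := congr1 (fun S : {set 'I_n} => l \in S) Kj.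
  by rewrite /= !inE (negPf li) /= => <-; rewrite ltnNge leq_eqVlt pos_neq.
have lE : perm_prefix (d * tperm i j)%g ((d^-1)%g l) = perm_prefix d ((d^-1)%g l).
  by rewrite prefixE // !inE lt_i_l lt_j_l.
have lSE : perm_prefix (d * tperm i j)%g ((d^-1)%g l).+1 = perm_prefix d ((d^-1)%g l).+1.
  apply: prefixE; rewrite !inE !ltnS.
  rewrite (leq_eqVlt ((d^-1)%g i)) (leq_eqVlt ((d^-1)%g j)) lt_i_l lt_j_l.
  rewrite (eq_sym (nat_of_ord ((d^-1)%g i))) (eq_sym (nat_of_ord ((d^-1)%g j))).
  by rewrite !pos_neq.
by rewrite lE lSE.
Qed.

End Swap.

(** * Minkowski summands of the permutohedron *)

Section Permutohedron.
Variables (R : realType) (n : nat).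
Implicit Types (d : 'S_n) (I J K S : {set 'I_n}) (u v x y : 'rV[R]_n).

(** The sum of the [#|I|] largest numbers in 1, ..., n, which is the maximum of the coordinate sum
    over [I] on the permutohedron. *)
Definition perm_height : set_function R n :=
  [ffun I : {set 'I_n} => \sum_(k < #|I|) (n%:R - k%:R)].

Lemma card_perm_prefix d k : (k <= n)%N -> #|perm_prefix d k| = k.
Proof.
elim: k => [|k IHk] kn; first by rewrite perm_prefix0 cards0.
rewrite (perm_prefixS d (Ordinal kn)) cardsU1 (perm_prefix_notin d (Ordinal kn)) /=.
by rewrite IHk 1?ltnW.
Qed.

Lemma greedy_perm_height d i : greedy perm_height d 0 i = n%:R - ((d^-1)%g i)%:R.
Proof.
rewrite mxE !ffunE !card_perm_prefix ?ltn_ord 1?ltnW ?ltn_ord //.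
by rewrite big_ord_recr /= addrAC subrr add0r.
Qed.

Lemma perm_height_form s :
  elementary_form s perm_height = if is_ci s then -1 else 0.
Proof.
move: s => [[i j] K]; rewrite /elementary_form; case: ifP => // /and3P[ij iK jK].
rewrite !ffunE !cardsU1 !inE negb_or ij iK jK /= !add1n !big_ord_recr /=.
by rewrite -natr1; ring.
Qed.

Lemma perm_height_submodular : submodular0 R n perm_height.
Proof.
split; last by rewrite ffunE cards0 big_ord0.
by apply/elementary_form_le0 => s; rewrite perm_height_form; case: ifP => _; lra.
Qed.

Lemma ci_of_perm_height : ci_of perm_height = set0.
Proof.
apply/seteqP; split=> // s /ci_ofE[sci]; rewrite perm_height_form sci => /eqP.
by rewrite oppr_eq0 oner_eq0.
Qed.

Lemma permutohedronE : permutohedron R n = Qpolytope perm_height.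
Proof.
rewrite (Q_hull perm_height_submodular) /permutohedron; congr conv_hull.
apply/seteqP; split=> _ [d _ <-].
  (* Position [k] of the greedy order carries the value [n - k], whence the reversal; the inverse
     exchanges positions and values. *)
  exists (d * perm (@rev_ord_inj n))^-1%g => //.
  apply/rowP => i; rewrite greedy_perm_height invgK permM permE mxE /=.
  by rewrite natrB // opprB addrC subrK.
exists (d^-1 * perm (@rev_ord_inj n))%g => //.
apply/rowP => i; rewrite greedy_perm_height mxE permM permE /=.
by rewrite subnSK // natrB // ltnW.
Qed.

Lemma Q_is_polytope (w : set_function R n) :
  submodular0 R n w -> is_polytope (Qpolytope w).
Proof.
move=> w_sub; exists (range (greedy w)); split; last exact: Q_hull.
  by apply: finite_image; exact: finite_finset.
by exists (greedy w 1%g); exists 1%g.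
Qed.

Lemma Q_minkowski_summand (w : set_function R n) : submodular0 R n w ->
  minkowski_summand (Qpolytope w) (permutohedron R n).
Proof.
move=> w_sub; split; first exact: Q_is_polytope.
rewrite permutohedronE; apply: ci_of_refines => //; first exact: perm_height_submodular.
by rewrite ci_of_perm_height.
Qed.

Lemma Q_coarsens (w : set_function R n) : submodular0 R n w ->
  coarsens_Sn_fan (normal_fan (Qpolytope w)).
Proof.
move=> w_sub; split; first by rewrite (Q_hull w_sub); apply: (polytope_normal_fan 1%g).
move=> u; have [d du] := chamber_exists u.
exists (normal_cone (Qpolytope w) (generic R d)).
  by rewrite Q_normal_fanE //; exists (generic R d).
move=> v uv; apply: chamber_normal_cone => // i j ij.
rewrite leNgt; apply/negP => /(proj2 (proj1 (uv _ _))).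
by rewrite ltNge du.
Qed.

Lemma polytope_max_face_neq0 (Q : set 'rV[R]_n) u : is_polytope Q -> max_face Q u !=set0.
Proof.
move=> [S [/finite_seqP[s ->] [x0 /= x0s] ->]].
have -> : [set` s] = range (tnth (in_tuple s)).
  apply/seteqP; split=> [x /= /(tnthP (in_tuple s))[i ->]|_ [i _ <-]].
    by exists i.
  exact: mem_tnth.
have s0 : (0 < size s)%N by case: s x0s.
exact: (max_face_neq0 (Ordinal s0)).
Qed.

Definition indicator S : 'rV[R]_n := \row_i (i \in S)%:R.

Lemma dot_indicator S x : dot (indicator S) x = \sum_(i in S) x 0 i.
Proof.
rewrite big_mkcond; apply: eq_bigr => i _; rewrite mxE.
by case: ifP => _; rewrite ?mul1r ?mul0r.
Qed.

Lemma chamber_indicator d k : chamber d (indicator (perm_prefix d k)).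
Proof.
move=> i j ij; rewrite !mxE !inE !permK ler_nat.
by case: ltnP => // jk; rewrite (leq_ltn_trans ij jk).
Qed.

Lemma conv_hull_convex (S : set 'rV[R]_n) : convex_set (conv_hull S).
Proof.
apply/convex_setP => x y t t0 t1 Sx Sy A [cA SA].
by move/convex_setP: (cA); apply => //; [apply: Sx|apply: Sy].
Qed.

(** By refinement the cone of the permutohedron containing the chamber lies in one cone of [Q], and
    any point of the corresponding face serves. *)
Lemma minkowski_summand_vertex (Q : set 'rV[R]_n) d :
  minkowski_summand Q (permutohedron R n) ->
  exists x, forall u, chamber d u -> max_face Q u x.
Proof.
rewrite permutohedronE => -[polQ ref].
have wP := perm_height_submodular.
have [|D] := ref (normal_cone (Qpolytope perm_height) (generic R d)).
  by rewrite Q_normal_fanE //; exists (generic R d).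
rewrite normal_fanE; last by move=> v; exact: polytope_max_face_neq0.
move=> [v _ <-] dv; have [x vx] := polytope_max_face_neq0 v polQ.
by exists x => u du; apply: (dv u) vx; apply: chamber_normal_cone du.
Qed.

Lemma minkowski_summand_Q (Q : set 'rV[R]_n) :
  minkowski_summand Q (permutohedron R n) ->
  exists2 w : set_function R n, submodular0 R n w & Q = Qpolytope w.
Proof.
move=> sumQ; have [vtx vtx_max] := choice (fun d => minkowski_summand_vertex d sumQ).
have [dS dSP] := choice (fun S => chamber_exists (indicator S)).
have Qvtx d : Q (vtx d) by have [] := vtx_max d _ (generic_chamber R d).
pose w : set_function R n := [ffun S => dot (indicator S) (vtx (dS S))].
have w_le S y : Q y -> \sum_(i in S) y 0 i <= w S.
  by rewrite ffunE -dot_indicator; have [_] := vtx_max _ _ (dSP S); apply.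
have wE d S : chamber d (indicator S) -> w S = \sum_(i in S) vtx d 0 i.
  move=> dind; apply/eqP; rewrite eq_le w_le // andbT ffunE -dot_indicator.
  by have [_] := vtx_max _ _ dind; apply.
have w_sub : submodular0 R n w.
  split=> [I J|]; last by rewrite ffunE dot_indicator finset.big_set0.
  (* An order sorting [indicator (I :&: J) + indicator (I :|: J)] sorts both summands, so the single
     point [vtx d] attains both maxima. As this sum is also [indicator I + indicator J], comparing
     with [w I] and [w J] gives submodularity. *)
  have [d du] := chamber_exists (indicator (I :&: J) + indicator (I :|: J)).
  have dI : chamber d (indicator (I :&: J)).
    move=> i j ij; have := du i j ij; rewrite !mxE !inE.
    by case: (_ \in I); case: (_ \in J); case: (_ \in I); case: (_ \in J) => //=; lra.
  have dU : chamber d (indicator (I :|: J)).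
    move=> i j ij; have := du i j ij; rewrite !mxE !inE.
    by case: (_ \in I); case: (_ \in J); case: (_ \in I); case: (_ \in J) => //=; lra.
  rewrite (wE d) // (wE d (I :|: J)) //.
  have := w_le I _ (Qvtx d); have := w_le J _ (Qvtx d).
  rewrite -!dot_indicator => wJ wI; apply: le_trans (lerD wI wJ).
  rewrite -!dotDl le_eqVlt; apply/orP; left; apply/eqP; congr dot.
  apply/rowP => i; rewrite !mxE !inE.
  by case: (_ \in I); case: (_ \in J) => //=; lra.
have greedy_vtx d : greedy w d = vtx d.
  apply/rowP => i; rewrite mxE !(wE d); try exact: chamber_indicator.
  by rewrite sum_prefixS permKV addrK.
exists w => //; apply/seteqP; split=> [y Qy|].
  split=> [|I _]; last exact: w_le.
  have sumT (x : 'rV[R]_n) : \sum_i x 0 i = \sum_(i in [set: 'I_n]%SET) x 0 i.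
    by apply: eq_bigl => i; rewrite inE.
  apply/eqP; rewrite sumT eq_le w_le // (wE 1%g); last first.
    by move=> i j _; rewrite !mxE !inE.
  (* Plus and minus the all-ones vector lie in every chamber, so the coordinate sum is constant on
     [Q]. *)
  have [|_ /(_ y Qy)] := @vtx_max 1%g (- indicator [set: 'I_n]%SET).
    by move=> i j _; rewrite !mxE !inE.
  by rewrite !dotNl !dot_indicator lerN2.
rewrite (Q_hull w_sub); apply: conv_hull_sub; last first.
  by move=> _ [d _ <-]; rewrite greedy_vtx.
by case: sumQ => -[S [_ _ ->]] _; apply: conv_hull_convex.
Qed.

End Permutohedron.

(** * Structural imsets *)

Section Imsets.
Variables (F : realFieldType) (n : nat).
Implicit Types (w : set_function F n) (u v : Defs.imset n) (s t : triple n).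

Definition pairing u w : F := \sum_(I : {set 'I_n}) (w I : F) * (u I)%:~R.

Lemma pairing_is_scalar u : scalar (pairing u).
Proof.
move=> k v w; rewrite /pairing mulr_sumr -big_split /=; apply: eq_bigr => I _.
by rewrite !ffunE /GRing.scale /=; ring.
Qed.

HB.instance Definition _ u := GRing.isLinear.Build F {ffun {set 'I_n} -> F^o} F *%R
  (pairing u) (@pairing_is_scalar u).

Lemma pairingD u v w : pairing (u + v) w = pairing u w + pairing v w.
Proof.
by rewrite -big_split /=; apply: eq_bigr => I _; rewrite ffunE rmorphD /= mulrDr.
Qed.

Lemma pairing0 w : pairing 0 w = 0.
Proof. by apply: big1 => I _; rewrite ffunE mulr0. Qed.

Lemma pairingN u w : pairing (- u) w = - pairing u w.
Proof. by apply/eqP; rewrite -addr_eq0 -pairingD addNr pairing0. Qed.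

Lemma pairingMn u w m : pairing (u *+ m) w = pairing u w *+ m.
Proof. by elim: m => [|m IHm]; rewrite ?pairing0 // !mulrS pairingD IHm. Qed.

Lemma pairing_sum (f : triple n -> Defs.imset n) (P : pred (triple n)) w :
  pairing (\sum_(s | P s) f s) w = \sum_(s | P s) pairing (f s) w.
Proof. exact: (big_morph (pairing^~ w) (fun u v => pairingD u v w) (pairing0 w)). Qed.

Lemma pairing_unit (I : {set 'I_n}) w : pairing (unit_imset I) w = w I.
Proof.
rewrite /pairing (bigD1 I) //= ffunE eqxx mulr1 big1 ?addr0 // => J /negPf JI.
by rewrite ffunE JI mulr0.
Qed.

Lemma pairing_elementary s w :
  is_ci s -> pairing (elementary_imset s) w = elementary_form s w.
Proof.
move: s => [[i j] K] sci; rewrite /elementary_imset /elementary_form sci.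
by rewrite !(pairingD, pairingN) !pairing_unit.
Qed.

Lemma pairing_structural u w : structural_imset u ->
  (forall s, elementary_form s w <= 0) -> pairing u w <= 0.
Proof.
move=> [m m0 [c uE]] w_loc; rewrite -(pmulrn_lle0 _ m0) -pairingMn uE.
rewrite pairing_sum.
by apply: sumr_le0 => s sci; rewrite pairingMn pairing_elementary // mulrn_wle0.
Qed.

End Imsets.

Section StructuralModels.
Variables (n : nat).
Implicit Types (u v : Defs.imset n) (s t : triple n).

Lemma elementary_structural (A : pred (triple n)) :
  structural_imset (\sum_(s | is_ci s && A s) elementary_imset s).
Proof.
exists 1%N => //; exists (fun s => A s : nat).
by rewrite mulr1n big_mkcondr /=; apply: eq_bigr => s _; case: (A s).
Qed.

Lemma common_denominator (I : finType) (c : I -> rat) : (forall i, 0 <= c i) ->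
  exists2 N : nat, (0 < N)%N & exists b : I -> nat, forall i, c i * N%:R = (b i)%:R.
Proof.
move=> c0; exists (\prod_i `|denq (c i)|)%N.
  by rewrite prodn_gt0 // => i; rewrite absz_gt0 denq_neq0.
exists (fun i => `|numq (c i)| * \prod_(j | j != i) `|denq (c j)|)%N => i.
rewrite (bigD1 i) //= !natrM mulrA; congr (_ * _).
rewrite -{1}(divq_num_den (c i)) !natr_absz.
rewrite !ger0_norm ?numq_ge0 ?denq_ge0 //.
by rewrite divfK // intr_eq0 denq_neq0.
Qed.

(* Farkas' lemma is used over the rationals, so that clearing denominators turns
   the multipliers into a certificate that [u *+ m - elementary_imset s] is
   structural. *)
Lemma separating_function u s : structural_imset u -> is_ci s -> ~ ci_model u s ->
  exists w : set_function rat n,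
    [/\ forall t, elementary_form t w <= 0, pairing u w = 0 & elementary_form s w < 0].
Proof.
move=> u_str sci su; apply: contrapT => no_w; apply: su; split=> //.
pose A (o : option (triple n)) : {scalar {ffun {set 'I_n} -> rat^o}} :=
  if o is Some t then elementary_form t else pairing (- u).
have [w Aw|c c0 cE] := farkas (A := A) (b := pairing (- elementary_imset s)).
  rewrite leNgt; apply/negP => sw; apply: no_w; exists w.
  have w_loc t : elementary_form t w <= 0 by have := Aw (Some t).
  split=> //.
    apply/eqP; rewrite eq_le pairing_structural //.
    by have := Aw None; rewrite /= pairingN oppr_le0.
  by move: sw; rewrite /= pairingN pairing_elementary // oppr_gt0.
have [N N0 [b bE]] := common_denominator c0.
(* Unit set functions turn the Farkas identity, multiplied by [N], into an identity between
   imsets. *)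
have key : u *+ b None - elementary_imset s *+ N =
    \sum_(t | is_ci t) elementary_imset t *+ b (Some t).
  apply/ffunP => J; apply: (@intr_inj rat).
  have evalJ (F : realFieldType) v :
      pairing v ([ffun I => (I == J)%:R] : set_function F n) = (v J)%:~R.
    rewrite /pairing (bigD1 J) //= ffunE eqxx mul1r big1 ?addr0 // => I /negPf IJ.
    by rewrite ffunE IJ mul0r.
  rewrite -!(evalJ rat); set w := finfun _.
  rewrite pairingD pairingN !pairingMn pairing_sum.
  have := congr1 (fun x => x * N%:R) (cE w); rewrite /= pairingN mulNr mulr_natr.
  have -> : \sum_i c i * A i w =
      - c None * pairing u w + \sum_t c (Some t) * elementary_form t w.
    rewrite (bigD1 None) //= pairingN mulrN mulNr; congr (_ + _).
    rewrite (reindex_omap Some id) => [|[t|] //].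
    by apply: eq_bigl => t; rewrite /= eqxx.
  rewrite mulrDl 2!mulNr mulrAC bE mulr_natl => sE.
  have -> : \sum_(t | is_ci t) pairing (elementary_imset t *+ b (Some t)) w =
      (\sum_t c (Some t) * elementary_form t w) * N%:R.
    rewrite mulr_suml big_mkcond /=; apply: eq_bigr => t _.
    rewrite mulrAC bE mulr_natl; case: ifP => [tci|/negbT tci].
      by rewrite pairingMn pairing_elementary.
    by rewrite elementary_form_not_ci // mul0rn.
  by move: sE; lra.
have [p p0 [q qE]] := u_str.
(* Adding [r] copies of [u] to the left side of [key] makes it [N] times
   [u *+ M - elementary_imset s]; [M] is large enough for [r] to be a true difference. The factor
   [p] turns the copies of [u] into elementary imsets. *)
pose M := (b None).+1; pose r := (N * M - b None)%N.
exists M => //; exists (p * N)%N; first by rewrite muln_gt0 p0.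
have bM : (b None <= N * M)%N by rewrite (leq_trans (leqnSn _)) // leq_pmull.
exists (fun t => r * q t + p * b (Some t))%N.
rewrite (eq_bigr (fun t =>
  elementary_imset t *+ q t *+ r + elementary_imset t *+ b (Some t) *+ p)).
  rewrite big_split /= !sumrMnl -qE -key !mulrnBl -!mulrnA addrA -mulrnDr.
  by congr (_ *+ _ - _ *+ _); rewrite /r; nia.
by move=> t _; rewrite mulrnDr -!mulrnA [(q t * r)%N]mulnC [(b _ * p)%N]mulnC.
Qed.

(** The sum of rational separators, one per statement outside the model, is strict at exactly these
    statements: inside the model, pairing with [u *+ m - elementary_imset s] forces equality.
    Subtracting a constant and embedding the rationals in [R] preserves the signs of the forms. *)
Lemma separating_function_exists (R : realType) u : structural_imset u ->
  exists2 w : set_function R n, submodular0 R n w & ci_of w = ci_model u.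
Proof.
move=> u_str.
have /choice[f fP] s : exists w : set_function rat n,
    [/\ forall t, elementary_form t w <= 0, pairing u w = 0 &
        is_ci s -> ~ ci_model u s -> elementary_form s w < 0].
  have [[sci su]|h] := pselect (is_ci s /\ ~ ci_model u s).
    by have [w [w1 w2 w3]] := separating_function u_str sci su; exists w.
  exists 0; split=> [t||sci su]; rewrite ?linear0 //.
  by case: h.
pose v : set_function rat n := \sum_s f s.
have v_loc s : elementary_form s v <= 0.
  by rewrite linear_sum; apply: sumr_le0 => t _; have [+ _ _] := fP t; apply.
have vu : pairing u v = 0 by rewrite linear_sum; apply: big1 => t _; have [] := fP t.
have vE s : is_ci s -> elementary_form s v = 0 <-> ci_model u s.
  move=> sci; split=> [sv|[_ [m m0 us]]].
    apply: contrapT => su; suff : elementary_form s v < 0 by rewrite sv ltxx.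
    rewrite linear_sum /= (bigD1 s) //=; have [_ _ /(_ sci su) fs] := fP s.
    have : \sum_(t | t != s) elementary_form s (f t) <= 0.
      by apply: sumr_le0 => t _; have [+ _ _] := fP t; apply.
    by move: fs; lra.
  apply/eqP; rewrite eq_le v_loc /=.
  have := pairing_structural us v_loc.
  by rewrite pairingD pairingN pairingMn vu mul0rn add0r oppr_le0 pairing_elementary.
pose w : set_function R n := [ffun I => ratr (v I : rat) - ratr (v finset.set0 : rat)].
have wE s : elementary_form s w = ratr (elementary_form s v).
  case: s => [[i j] K]; rewrite /elementary_form; case: ifP => _; last by rewrite rmorph0.
  by rewrite !ffunE !(rmorphB, rmorphD) /=; ring.
exists w.
  split; last by rewrite ffunE subrr.
  by apply/elementary_form_le0 => s; rewrite wE lerq0.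
apply/seteqP; split=> s.
  move=> /ci_ofE[sci]; rewrite wE => /eqP; rewrite fmorph_eq0 => /eqP.
  by move/(vE s sci).
move=> su; have sci : is_ci s by case: su.
by apply/ci_ofE; split=> //; rewrite wE (proj2 (vE s sci) su) rmorph0.
Qed.

(** The sum [u] of the elementary imsets of all statements of [w] pairs to 0 with [w], so a
    statement in its model has form at least 0 at [w], hence 0. Conversely, removing one summand of
    [u] leaves a structural imset. *)
Lemma ci_of_structural (R : realType) (w : set_function R n) : submodular0 R n w ->
  structural_ci_model (ci_of w).
Proof.
move=> [/elementary_form_le0 w_loc _].
pose u : Defs.imset n := \sum_(s | is_ci s && `[< ci_of w s >]) elementary_imset s.
exists u; first exact: elementary_structural.
have wu : pairing u w = 0.
  rewrite pairing_sum big1 // => s /andP[sci /asboolP/ci_ofE[_ sw]].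
  by rewrite pairing_elementary.
apply/seteqP; split=> s.
  move=> sw; have sci : is_ci s by case/ci_ofE: sw.
  split=> //; exists 1%N => //.
  rewrite mulr1n /u (bigD1 s) /=; last by rewrite sci; apply/asboolP.
  rewrite addrAC subrr add0r; under eq_bigl do rewrite -andbA.
  exact: elementary_structural.
move=> [sci [m m0 us]]; apply/ci_ofE; split=> //; apply/eqP; rewrite eq_le w_loc /=.
have := pairing_structural us w_loc.
by rewrite pairingD pairingN pairingMn wu mul0rn add0r oppr_le0 pairing_elementary.
Qed.

End StructuralModels.

(** * The correspondence between the four kinds of objects *)

Section Correspondence.
Variables (R : realType) (n : nat).
Implicit Types (w : set_function R n).

Lemma smallest_face_cone_faces w : submodular w -> cone_faces R n (smallest_face w).
Proof.
move=> w_sub; split; last by exists w; rewrite smallest_faceE //; split.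
by rewrite smallest_face_tight // submodular_coneE; exact: tight_is_face.
Qed.

Lemma cone_faces_smallest_face (F : set (set_function R n)) : cone_faces R n F ->
  exists2 w, submodular0 R n w & F = smallest_face w.
Proof.
rewrite /cone_faces submodular_coneE => -[F_face F0].
have [v Fv FE] := face_tightE F_face F0.
have v_loc : forall s, elementary_form s v <= 0 by move: Fv; rewrite FE => -[].
pose w : set_function R n := [ffun I => v I - v finset.set0].
have wE s : elementary_form s w = elementary_form s v.
  case: s => [[i j] K]; rewrite /elementary_form; case: ifP => // _.
  by rewrite !ffunE; ring.
have w_sub : submodular w by apply/elementary_form_le0 => s; rewrite wE.
exists w; first by split=> //; rewrite ffunE subrr.
rewrite smallest_face_tight // FE.
have tE : tight (@elementary_form R n) v = tight (@elementary_form R n) w.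
  by apply/setP => s; rewrite !inE /= wE.
by rewrite tE.
Qed.

Lemma smallest_face_ci_of w w' : submodular0 R n w -> submodular0 R n w' ->
  smallest_face w = smallest_face w' <-> ci_of w = ci_of w'.
Proof.
move=> [w_sub _] [w'_sub _]; rewrite !smallest_faceE //; split=> [E|-> //].
have [_ ww'] : [set v | submodular v /\ ci_of w `<=` ci_of v] w' by rewrite E; split.
have [_ w'w] : [set v | submodular v /\ ci_of w' `<=` ci_of v] w by rewrite -E; split.
exact/seteqP.
Qed.

Lemma rank_test_ci_of w w' : submodular0 R n w -> submodular0 R n w' ->
  to_rank_test w = to_rank_test w' -> ci_of w = ci_of w'.
Proof.
move=> w_sub w'_sub ww'.
have sub v v' : submodular0 R n v -> submodular0 R n v' ->
    to_rank_test v = to_rank_test v' -> ci_of v `<=` ci_of v'.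
  move=> v_sub v'_sub vv' [[i j] K] sv; have sci : is_ci (i, j, K) by case: sv.
  have [d [d' dd']] := greedy_adjacent R sci.
  by apply/dd'/(rank_test_greedy d d' v_sub v'_sub vv')/dd'.
by apply/seteqP; split; apply: sub.
Qed.

Lemma to_summand_eq w w' : submodular0 R n w -> submodular0 R n w' ->
  to_summand w = to_summand w' <->
  normal_fan (Qpolytope w) = normal_fan (Qpolytope w').
Proof.
move=> w_sub w'_sub; rewrite /to_summand /normal_class; split=> [E|-> //].
have [//] : [set Q | is_polytope Q /\ normal_fan Q = normal_fan (Qpolytope w')]
    (Qpolytope w).
by rewrite -E; split=> //; apply: Q_is_polytope.
Qed.

End Correspondence.

(** Maps with the same fibers on [A] factor through each other; [v0] is the value of [h] off the
    image of [f]. *)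
Lemma set_bij_image (T U V : Type) (A : set T) (f : T -> U) (g : T -> V) (v0 : V) :
  (forall x y, A x -> A y -> f x = f y <-> g x = g y) ->
  exists2 h : U -> V, set_bij (f @` A) (g @` A) h & forall x, A x -> h (f x) = g x.
Proof.
move=> fg; have /choice[h hE] u : exists v, forall x, A x -> f x = u -> v = g x.
  have [[x Ax fx]|noA] := pselect (exists2 x, A x & f x = u); last first.
    by exists v0 => x Ax fx; case: noA; exists x.
  by exists (g x) => y Ay fy; apply/(fg x y Ax Ay); rewrite fx fy.
have hf x : A x -> h (f x) = g x by move=> Ax; exact: hE.
exists h => //; split.
- by move=> _ [x Ax <-]; rewrite hf //; exists x.
- move=> _ _ /set_mem[x Ax <-] /set_mem[y Ay <-]; rewrite !hf //.
  by move=> /(fg x y Ax Ay).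
- by move=> _ [x Ax <-]; exists (f x); [exists x|exact: hf].
Qed.

Theorem theorem10 (R : realType) (n : nat) (hn : (0 < n)%N) :
  (* every Q_w is a Minkowski summand, and its normal fan coarsens the S_n-fan *)
  (forall w : set_function R n, submodular0 R n w ->
     minkowski_summand (Qpolytope w) (permutohedron R n) /\
     coarsens_Sn_fan (normal_fan (Qpolytope w))) /\
  (* the four assignments map onto the four sets of objects *)
  [/\ [set to_rank_test w | w in submodular0 R n] = rank_tests R n,
      [set to_summand w | w in submodular0 R n] = summand_classes R n,
      [set ci_of w | w in submodular0 R n] = ci_models n
    & [set smallest_face w | w in submodular0 R n] = cone_faces R n] /\
  (* coincidence for one kind implies coincidence for all four *)
  (forall w w' : set_function R n, submodular0 R n w -> submodular0 R n w' ->
     [<-> to_rank_test w = to_rank_test w';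
          normal_fan (Qpolytope w) = normal_fan (Qpolytope w');
          ci_of w = ci_of w';
          smallest_face w = smallest_face w']) /\
  (* hence the canonical bijections between the four kinds of objects *)
  (exists (f2 : {set {set 'S_n}} -> set (set 'rV[R]_n))
          (f3 : {set {set 'S_n}} -> set (triple n))
          (f4 : {set {set 'S_n}} -> set (set_function R n)),
     [/\ set_bij (rank_tests R n) (summand_classes R n) f2,
         set_bij (rank_tests R n) (ci_models n) f3,
         set_bij (rank_tests R n) (cone_faces R n) f4
       & forall w : set_function R n, submodular0 R n w ->
           [/\ f2 (to_rank_test w) = to_summand w,
               f3 (to_rank_test w) = ci_of w
             & f4 (to_rank_test w) = smallest_face w]]).
Proof.
have equiv (w w' : set_function R n) : submodular0 R n w -> submodular0 R n w' ->
     [<-> to_rank_test w = to_rank_test w';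
          normal_fan (Qpolytope w) = normal_fan (Qpolytope w');
          ci_of w = ci_of w';
          smallest_face w = smallest_face w'].
  move=> w_sub w'_sub; tfae.
  - by move=> /(rank_test_ci_of w_sub w'_sub)/(ci_of_normal_fan w_sub w'_sub).
  - by move=> fanE; apply: rank_test_ci_of => //; rewrite /to_rank_test fanE.
  - by move=> /(smallest_face_ci_of w_sub w'_sub).
  - move=> /(smallest_face_ci_of w_sub w'_sub)/(ci_of_normal_fan w_sub w'_sub).
    by rewrite /to_rank_test => ->.
have onto1 : [set to_rank_test w | w in submodular0 R n] = rank_tests R n.
  apply/seteqP; split=> [_ [w w_sub <-]|_ [_ [_ ->] [w w_sub ->]]]; last by exists w.
  exists (normal_fan (Qpolytope w)); last by exists w.
  by split=> //; exact: Q_coarsens.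
have onto2 : [set to_summand w | w in submodular0 R n] = summand_classes R n.
  apply/seteqP; split=> [_ [w w_sub <-]|_ [Q sumQ <-]].
    by exists (Qpolytope w) => //; exact: Q_minkowski_summand.
  by have [w w_sub ->] := minkowski_summand_Q sumQ; exists w.
have onto3 : [set ci_of w | w in submodular0 R n] = ci_models n.
  apply/seteqP; split=> [_ [w w_sub <-]|_ [u u_str ->]]; first exact: ci_of_structural.
  by have [w w_sub <-] := separating_function_exists R u_str; exists w.
have onto4 : [set smallest_face w | w in submodular0 R n] = cone_faces R n.
  apply/seteqP; split=> [_ [w [w_sub _] <-]|F]; first exact: smallest_face_cone_faces.
  by move=> /cone_faces_smallest_face[w w_sub ->]; exists w.
split; first by move=> w w_sub; split; [exact: Q_minkowski_summand|exact: Q_coarsens].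
split; first by split.
split; first exact: equiv.
have [|f2 bij2 f2E] := @set_bij_image _ _ _ (submodular0 R n)
    (@to_rank_test R n) (@to_summand R n) set0.
  move=> w w' w_sub w'_sub; rewrite to_summand_eq //.
  exact: (equiv _ _ w_sub w'_sub 0 1)%N.
have [|f3 bij3 f3E] := @set_bij_image _ _ _ (submodular0 R n)
    (@to_rank_test R n) (@ci_of n R) set0.
  by move=> w w' w_sub w'_sub; exact: (equiv _ _ w_sub w'_sub 0 2)%N.
have [|f4 bij4 f4E] := @set_bij_image _ _ _ (submodular0 R n)
    (@to_rank_test R n) (@smallest_face R n) set0.
  by move=> w w' w_sub w'_sub; exact: (equiv _ _ w_sub w'_sub 0 3)%N.
rewrite -onto1 -onto2 -onto3 -onto4; exists f2, f3, f4; split=> // w w_sub.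
by split; [exact: f2E|exact: f3E|exact: f4E].
Qed.
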